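(* Let $X$ be a uniformly locally finite $\mathrm{CAT}(0)$ cube complex with no free faces, and let $\mathcal{C}(X)$ be its contact graph. Then the natural homomorphism $\iota\colon\mathrm{Aut}\,X\to\mathrm{Aut}\,\mathcal{C}(X)$ is a group isomorphism.
   Context: $\mathrm{Aut}\,X$ is the group of cubical automorphisms of $X$. Uniformly locally finite means that there is a uniform upper bound on the number of edges incident to a vertex. An automorphism of a graph is a self-bijection of its vertex set preserving adjacency (in both directions). The contact graph $\mathcal{C}(X)$ has the hyperplanes of $X$ as vertices, and two distinct hyperplanes are joined by an edge if and only if no third hyperplane separates them (equivalently, their carriers intersect, the carrier of a hyperplane being the union of all cubes intersecting it). The action of $\mathrm{Aut}\,X$ on the set of hyperplanes induces the natural homomorphism $\iota$. A free face is a non-maximal cube that is contained in a unique maximal cube. *)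

(* Defs.v *)
From HB Require Import structures.
From Stdlib Require Import Relation_Operators.
From mathcomp Require Import all_boot.
From mathcomp Require Import all_classical.

Set Implicit Arguments.
Unset Strict Implicit.
Unset Printing Implicit Defensive.

Local Open Scope classical_set_scope.
Local Open Scope card_scope.

(** A cube complex is presented by its vertex set and the vertex sets of its
    cubes. [cube_face] describes the vertex sets of the nonempty faces of the
    cube [0,1]^n. The axioms are those of Bridson-Haefliger, Definition I.7.32:
    every cube is an embedded copy of some [0,1]^n, the cubes inside it are
    exactly its faces, and two cubes that meet do so in a common face. Every
    CAT(0) cube complex has these properties, and its cubes are therefore
    determined by their vertex sets. *)

Definition cube_face n (F : set {ffun 'I_n -> bool}) : Prop :=
  exists (D : {set 'I_n}) (a : {ffun 'I_n -> bool}),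
    F = [set x | forall i, i \in D -> x i = a i].

Record cubeComplex := CubeComplex {
  vertex :> Type;
  cube : set (set vertex);
  cube_vertex : forall v, cube [set v];
  cube_chart : forall C, cube C ->
    exists n (p : {ffun 'I_n -> bool} -> vertex),
      [/\ injective p, range p = C &
          forall D, D `<=` C ->
            (cube D <-> exists F, cube_face F /\ D = p @` F)];
  cube_inter : forall C D, cube C -> cube D -> C `&` D !=set0 ->
    cube (C `&` D)
}.
Arguments cube {c} _.

Section CubeComplex.
Variable X : cubeComplex.
Implicit Types (a b c d u v w : X) (C D E F M : set X) (S : set X).

Definition adjacent u v : Prop := u <> v /\ cube [set u; v].

Definition edge : set (set X) :=
  [set E | exists u v, adjacent u v /\ E = [set u; v]].

(* A 2-cube whose vertices are a, b, c, d in this cyclic order. *)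
Definition square a b c d : Prop :=
  [/\ cube [set a; b; c; d], a <> c /\ b <> d,
      adjacent a b /\ adjacent b c & adjacent c d /\ adjacent d a].

Definition uniformly_locally_finite : Prop :=
  exists N : nat, forall v, [set E | edge E /\ E v] #<= `I_N.

Definition maximal_cube M : Prop :=
  cube M /\ forall C, cube C -> M `<=` C -> C = M.

Definition free_face F : Prop :=
  [/\ cube F, ~ maximal_cube F & exists! M, maximal_cube M /\ F `<=` M].

Definition no_free_faces : Prop := forall F, ~ free_face F.

(* The link of v is a simplicial complex on the neighbours of v; a cube C
   containing v contributes the simplex spanned by the neighbours of v in C
   (the empty simplex if C = {v}). *)
Definition link_simplex v S : Prop :=
  exists C, [/\ cube C, C v & S = [set u | C u /\ adjacent v u]].

(* Taking u = w, the hypothesis says that every element of S is a vertex of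
   the link; for u <> w it says that u and w are joined by an edge in it. *)
Definition flag_link v : Prop :=
  forall S, finite_set S ->
    (forall u w, S u -> S w -> link_simplex v [set u; w]) ->
    link_simplex v S.

Definition edge_path u (p : seq X) : Prop :=
  path (fun x y => `[< adjacent x y >]) u p.

(* Elementary homotopies: an edge-path is changed by removing a backtrack, or
   by pushing it across a square. *)
Inductive elementary_homotopy : seq X -> seq X -> Prop :=
| backtrack s u v t : adjacent u v ->
    elementary_homotopy (s ++ [:: u; v; u] ++ t) (s ++ [:: u] ++ t)
| across_square s a b c d t : square a b c d ->
    elementary_homotopy (s ++ [:: a; b; c] ++ t) (s ++ [:: a; d; c] ++ t).

Definition homotopic : seq X -> seq X -> Prop :=
  clos_refl_sym_trans (seq X) elementary_homotopy.

Definition connected_complex : Prop :=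
  forall u v, exists p, edge_path u p /\ last u p = v.

(* Triviality of the edge-path group, that is, of the fundamental group. *)
Definition simply_connected : Prop :=
  connected_complex /\
  forall u p, edge_path u p -> last u p = u -> homotopic (u :: p) [:: u].

(* Gromov's link condition, together with simple connectedness. *)
Definition CAT0 : Prop := simply_connected /\ forall v, flag_link v.

Definition opposite_edges E F : Prop :=
  exists a b c d, [/\ square a b c d, E = [set a; b] & F = [set d; c]].

Definition parallel : set X -> set X -> Prop :=
  clos_refl_sym_trans (set X) opposite_edges.

(* A hyperplane is encoded as the set of edges that it crosses. *)
Definition hyperplanes : set (set (set X)) :=
  [set H | exists E, edge E /\ H = [set F | parallel E F]].

Definition hyperplane : Type := set_type hyperplanes.

(* [same_side W u v]: u and v lie in the same component of the complement of
   the hyperplane W. *)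
Definition same_side (W : set (set X)) : X -> X -> Prop :=
  clos_refl_sym_trans X (fun u v => adjacent u v /\ ~ W [set u; v]).

(* W separates H from K if H and K lie in different components of the
   complement of W. If H crosses W, the edges of H have endpoints on both sides
   of W, so the condition fails, as it should; likewise for K. *)
Definition separates (W H K : set (set X)) : Prop :=
  forall E F u v, H E -> E u -> K F -> F v -> ~ same_side W u v.

Definition contact (H K : hyperplane) : Prop :=
  H <> K /\
  ~ exists W : hyperplane, [/\ W <> H, W <> K &
                               separates (val W) (val H) (val K)].

Lemma contact_irrefl H : ~ contact H H.
Proof. by case. Qed.

Lemma contact_sym H K : contact H K -> contact K H.
Proof.
move=> [nHK nsep]; split; first by move=> e; apply: nHK.
move=> [W [WK WH sep]]; apply: nsep; exists W; split=> //.
by move=> E F u v HE Eu KF Fv s; apply: (sep F E v u) => //; apply: rst_sym.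
Qed.

End CubeComplex.

Record graph := Graph {
  node :> Type;
  adj : node -> node -> Prop;
  adj_irrefl : forall x, ~ adj x x;
  adj_sym : forall x y, adj x y -> adj y x
}.

Definition contact_graph (X : cubeComplex) : graph :=
  Graph (@contact_irrefl X) (@contact_sym X).

Record selfbij (T : Type) := SelfBij {
  sb_fun :> T -> T;
  sb_inv : T -> T;
  sb_funK : cancel sb_fun sb_inv;
  sb_invK : cancel sb_inv sb_fun
}.

HB.instance Definition _ T := gen_eqMixin (selfbij T).
HB.instance Definition _ T := gen_choiceMixin (selfbij T).

Section SelfBij.
Variable T : Type.
Implicit Types f g h : selfbij T.

Lemma selfbijP f g : f =1 g -> f = g.
Proof.
case: f g => [f f' fK f'K] [g g' gK g'K] /= /funext e; subst g.
have e' : f' = g' by apply: funext => x; rewrite -{1}[x]g'K.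
by subst g'; rewrite (Prop_irrelevance fK gK) (Prop_irrelevance f'K g'K).
Qed.

Definition sb_one : selfbij T := @SelfBij T id id (frefl id) (frefl id).
Definition sb_mul f g : selfbij T :=
  SelfBij (can_comp (sb_funK f) (sb_funK g)) (can_comp (sb_invK g) (sb_invK f)).
Definition sb_opp f : selfbij T := SelfBij (sb_invK f) (sb_funK f).

Lemma sb_mulA : associative sb_mul.
Proof. by move=> f g h; apply: selfbijP. Qed.
Lemma sb_mul1 : left_id sb_one sb_mul.
Proof. by move=> f; apply: selfbijP. Qed.
Lemma sb_mulr1 : right_id sb_one sb_mul.
Proof. by move=> f; apply: selfbijP. Qed.
Lemma sb_mulV : left_inverse sb_one sb_opp sb_mul.
Proof. by move=> f; apply: selfbijP => x; apply: sb_funK. Qed.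
Lemma sb_mulrV : right_inverse sb_one sb_opp sb_mul.
Proof. by move=> f; apply: selfbijP => x; apply: sb_invK. Qed.

HB.instance Definition _ :=
  isGroup.Build (selfbij T) sb_mulA sb_mul1 sb_mulr1 sb_mulV sb_mulrV.

End SelfBij.

(* A cubical automorphism is determined by its action on vertices, since cubes
   are determined by their vertex sets. *)
Definition cubical (X : cubeComplex) : {pred selfbij X} :=
  fun f => `[< forall C : set X, cube (f @` C) <-> cube C >].

Lemma cubicalP (X : cubeComplex) (f : selfbij X) :
  reflect (forall C : set X, cube (f @` C) <-> cube C) (f \in @cubical X).
Proof. exact: asboolP. Qed.

Lemma cubical1 (X : cubeComplex) : (1%g : selfbij X) \in @cubical X.
Proof. by apply/cubicalP => C; rewrite image_id. Qed.

Lemma cubicalM (X : cubeComplex) :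
  {in @cubical X &, forall f g, (f * g)%g \in @cubical X}.
Proof.
move=> f g /cubicalP cf /cubicalP cg; apply/cubicalP => C.
have -> : (f * g)%g @` C = f @` (g @` C) by rewrite image_comp.
by split=> [/cf/cg|/cg/cf].
Qed.

Lemma cubicalV (X : cubeComplex) :
  {in @cubical X, forall f, (f^-1)%g \in @cubical X}.
Proof.
move=> f /cubicalP cf; apply/cubicalP => C.
have fK : f @` ((f^-1)%g @` C) = C.
  rewrite image_comp (_ : _ \o _ = id) ?image_id //.
  by apply/funext/(@sb_invK _ f).
by rewrite -[in X in _ <-> X]fK; split=> /cf.
Qed.

Lemma cubical_group (X : cubeComplex) : group_closed (@cubical X).
Proof.
split=> [|f g Pf Pg]; first exact: cubical1.
by apply: cubicalM => //; apply: cubicalV.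
Qed.

Definition cubeAut (X : cubeComplex) :=
  {f : selfbij X | f \in @cubical X}.
HB.instance Definition _ (X : cubeComplex) := SubChoice.on (cubeAut X).
HB.instance Definition _ (X : cubeComplex) :=
  SubChoice_isSubGroup.Build (selfbij X) (@cubical X) (cubeAut X)
    (@cubical_group X).

Definition graph_preserving (G : graph) : {pred selfbij G} :=
  fun f => `[< forall x y : G, adj (f x) (f y) <-> adj x y >].

Lemma graph_preservingP (G : graph) (f : selfbij G) :
  reflect (forall x y : G, adj (f x) (f y) <-> adj x y)
          (f \in @graph_preserving G).
Proof. exact: asboolP. Qed.

Lemma graph_preserving1 (G : graph) :
  (1%g : selfbij G) \in @graph_preserving G.
Proof. exact/graph_preservingP. Qed.

Lemma graph_preservingM (G : graph) :
  {in @graph_preserving G &, forall f g, (f * g)%g \in @graph_preserving G}.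
Proof.
move=> f g /graph_preservingP af /graph_preservingP ag.
by apply/graph_preservingP => x y; split=> [/af/ag|/ag/af].
Qed.

Lemma graph_preservingV (G : graph) :
  {in @graph_preserving G, forall f, (f^-1)%g \in @graph_preserving G}.
Proof.
move=> f /graph_preservingP af; apply/graph_preservingP => x y.
by split=> [/af|h]; last apply/af; rewrite !(@sb_invK _ f).
Qed.

Lemma graph_preserving_group (G : graph) : group_closed (@graph_preserving G).
Proof.
split=> [|f g Pf Pg]; first exact: graph_preserving1.
by apply: graph_preservingM => //; apply: graph_preservingV.
Qed.

Definition graphAut (G : graph) :=
  {f : selfbij G | f \in @graph_preserving G}.
HB.instance Definition _ (G : graph) := SubChoice.on (graphAut G).
HB.instance Definition _ (G : graph) :=
  SubChoice_isSubGroup.Build (selfbij G) (@graph_preserving G) (graphAut G)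
    (@graph_preserving_group G).

Section Iota.
Variable X : cubeComplex.
Implicit Types (f g : cubeAut X) (H K W : hyperplane X).

Let inj_aut f : injective (val f) := can_inj (sb_funK (val f)).

Lemma cube_autE f (C : set X) : cube (val f @` C) <-> cube C.
Proof. by move: C; apply/cubicalP/(valP f). Qed.

Lemma adjacent_aut f (u v : X) : adjacent u v -> adjacent (val f u) (val f v).
Proof.
move=> [nuv cuv]; split; first by move/inj_aut.
by rewrite -image_set1 -[[set val f v]]image_set1 -image_setU; apply/cube_autE.
Qed.

Lemma square_aut f (a b c d : X) :
  square a b c d -> square (val f a) (val f b) (val f c) (val f d).
Proof.
move=> [cS [ac bd] [ab bc] [cd da]]; split.
- by move/(cube_autE f): cS; rewrite !image_setU !image_set1.
- by split=> /inj_aut.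
- by split; apply: adjacent_aut.
- by split; apply: adjacent_aut.
Qed.

Lemma parallel_aut f (E F : set X) :
  parallel E F -> parallel (val f @` E) (val f @` F).
Proof.
elim=> {E F} [E F [a [b [c [d [sq -> ->]]]]]|E|E F _|E F G _ EF _].
- apply: rst_step; exists (val f a), (val f b), (val f c), (val f d).
  by rewrite !image_setU !image_set1; split=> //; apply: square_aut.
- exact: rst_refl.
- exact: rst_sym.
- exact: rst_trans.
Qed.

Lemma image_autK f (E : set X) : val (f^-1)%g @` (val f @` E) = E.
Proof.
rewrite image_comp (_ : _ \o _ = id) ?image_id //.
by apply/funext => x /=; apply: sb_funK.
Qed.

Lemma image_autVK f (E : set X) : val f @` (val (f^-1)%g @` E) = E.
Proof.
rewrite image_comp (_ : _ \o _ = id) ?image_id //.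
by apply/funext => x /=; apply: sb_invK.
Qed.

Definition image_edges f (H : set (set X)) : set (set X) :=
  (fun E => val f @` E) @` H.

Lemma hyperplane_aut f H : image_edges f (val H) \in @hyperplanes X.
Proof.
have /set_mem [E [[u [v [uv ->]]] ->]] := valP H; apply/mem_set.
exists (val f @` [set u; v]); split.
  exists (val f u), (val f v); split; first exact: adjacent_aut.
  by rewrite image_setU !image_set1.
apply/seteqP; split=> [_ [F EF <-]|F]; first exact: parallel_aut.
move=> /(parallel_aut (f^-1)%g); rewrite image_autK => EF.
by exists (val (f^-1)%g @` F) => //; apply: image_autVK.
Qed.

Definition hyp_image f H : hyperplane X :=
  exist _ (image_edges f (val H)) (hyperplane_aut f H).

Lemma val_hyp_image f H : val (hyp_image f H) = image_edges f (val H).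
Proof. by []. Qed.

Lemma hyp_imageM f g H :
  hyp_image (f * g)%g H = hyp_image f (hyp_image g H).
Proof.
apply: val_inj; rewrite !val_hyp_image /image_edges image_comp.
by congr (_ @` _); apply/funext => E /=; rewrite image_comp.
Qed.

Lemma hyp_image1 H : hyp_image 1%g H = H.
Proof.
apply: val_inj; rewrite val_hyp_image /image_edges.
rewrite (_ : (fun _ => _) = id) ?image_id //.
by apply/funext => E; rewrite [LHS]image_id.
Qed.

Lemma hyp_imageK f : cancel (hyp_image f) (hyp_image (f^-1)%g).
Proof. by move=> H; rewrite -hyp_imageM mulVg hyp_image1. Qed.

Lemma hyp_imageVK f : cancel (hyp_image (f^-1)%g) (hyp_image f).
Proof. by move=> H; rewrite -hyp_imageM mulgV hyp_image1. Qed.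

Definition hyp_bij f : selfbij (contact_graph X) :=
  @SelfBij (contact_graph X) _ _ (hyp_imageK f) (hyp_imageVK f).

Lemma same_side_aut f (W : set (set X)) u v :
  same_side W u v -> same_side (image_edges f W) (val f u) (val f v).
Proof.
elim=> {u v} [u v [uv nW]|u|u v _|u v w _ uv _].
- apply: rst_step; split; first exact: adjacent_aut.
  move=> [E WE]; rewrite -!image_set1 -image_setU.
  move/(congr1 (image^~ (val (f^-1)%g))); rewrite !image_autK => e.
  by rewrite -e in nW.
- exact: rst_refl.
- exact: rst_sym.
- exact: rst_trans.
Qed.

Lemma separates_aut f (W H K : set (set X)) :
  separates (image_edges f W) (image_edges f H) (image_edges f K) ->
  separates W H K.
Proof.
move=> sep E F u v HE Eu KF Fv /(same_side_aut f).
by apply: (sep (val f @` E) (val f @` F)); [exists E|exists u|exists F|exists v].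
Qed.

Lemma contact_aut f H K : contact H K -> contact (hyp_image f H) (hyp_image f K).
Proof.
move=> [nHK nsep]; split; first by move/(can_inj (hyp_imageK f)).
move=> [W [WH WK sep]]; apply: nsep; exists (hyp_image (f^-1)%g W); split.
- by move=> e; apply: WH; rewrite -e hyp_imageVK.
- by move=> e; apply: WK; rewrite -e hyp_imageVK.
- by apply: (@separates_aut f); rewrite -[image_edges f _]val_hyp_image hyp_imageVK.
Qed.

Lemma hyp_bij_graph f : hyp_bij f \in @graph_preserving (contact_graph X).
Proof.
apply/graph_preservingP => H K; split; last exact: contact_aut.
move/(contact_aut (f^-1)%g).
by rewrite !(hyp_imageK f).
Qed.

Definition iota_aut f : graphAut (contact_graph X) :=
  exist _ (hyp_bij f) (hyp_bij_graph f).

End Iota.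

(* Main.v *)
Require Import Defs.
From HB Require Import structures.
From Stdlib Require Import Relation_Operators.
From mathcomp Require Import all_boot.
From mathcomp Require Import all_classical.
From mathcomp Require Import zify.

(** Let W(v) be the set of hyperplanes whose carrier contains the vertex v.
    Carriers are convex, so they have the Helly property, and two distinct
    hyperplanes are in contact exactly when their carriers meet; hence every
    finite clique of the contact graph lies in some W(v). If W(v) were
    contained in W(x) for some x <> v, then the first edge of a geodesic from v
    to x would be joined in the link of v to every other edge at v, and deleting
    it from a maximal cube at v would leave a free face. So the sets W(v) are
    finite maximal cliques that determine v, and an automorphism of the contact
    graph permutes the vertices of X. The same argument in the link of an edge
    vw shows that v and w are the only x with W(x) containing the intersection
    of W(v) and W(w); this characterizes adjacency, and it identifies the
    hyperplane dual to vw.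

    The theory of hyperplanes rests on the quadrangle condition for the graph
    metric. To obtain it from simple connectedness, edge-paths are considered up
    to moves across squares, and each vertex y acts on the classes of reduced
    paths, by appending y or by cancelling a last edge that starts at y. The link
    condition makes this action invariant under homotopy, so homotopic reduced
    paths differ only by moves across squares. *)

Set Implicit Arguments.
Unset Strict Implicit.
Unset Printing Implicit Defensive.

Local Open Scope classical_set_scope.

(** * Cubes and links *)

HB.instance Definition _ (X : cubeComplex) := gen_eqMixin X.

Section Hypercube.
Variable n : nat.
Implicit Types (a b : {ffun 'I_n -> bool}) (i j : 'I_n).

Definition flipc a i : {ffun 'I_n -> bool} := [ffun j => a j (+) (j == i)].

Lemma flipcK a i : flipc (flipc a i) i = a.
Proof. by apply/ffunP => j; rewrite !ffunE addbK. Qed.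

Lemma flipcC a i j : flipc (flipc a i) j = flipc (flipc a j) i.
Proof. by apply/ffunP => k; rewrite !ffunE addbAC. Qed.

Lemma flipc_inj a : injective (flipc a).
Proof.
by move=> i j /ffunP/(_ i); rewrite !ffunE eqxx => /addbI/esym/eqP.
Qed.

Lemma flipc_neq a i : flipc a i <> a.
Proof. by move/ffunP/(_ i); rewrite ffunE eqxx; case: (a i). Qed.

Lemma hypercube_ind (P : {ffun 'I_n -> bool} -> Prop) a0 :
  P a0 -> (forall a i, P a -> P (flipc a i)) -> forall a, P a.
Proof.
move=> P0 PS a; move: {2}(#|_|) (leqnn #|[set i | a i != a0 i]%SET|) => m.
elim: m a => [|m IH] a.
  rewrite leqn0 cards_eq0 => /eqP/setP e.
  suff -> : a = a0 by [].
  by apply/ffunP => i; have := e i; rewrite !inE => /negbFE/eqP.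
case: (set_0Vmem [set i | a i != a0 i]%SET) => [e _|[i]].
  by apply: IH; rewrite e cards0.
rewrite inE => ai le; rewrite -(flipcK a i); apply/PS/IH.
have : ([set j | flipc a i j != a0 j] \subset [set j | a j != a0 j] :\ i)%SET.
  apply/fintype.subsetP => j; rewrite !inE ffunE.
  case: (eqVneq j i) => [->|_] /=; last by rewrite addbF.
  by move: ai; case: (a i) (a0 i) => [] [].
move/subset_leq_card/leq_trans; apply.
by rewrite -ltnS (leq_trans _ le) // [leqRHS](cardsD1 i) inE ai.
Qed.

End Hypercube.

Section CubeStructure.
Variable X : cubeComplex.
Implicit Types (a b c d u v w : X) (C D : set X).

Lemma adjC u v : adjacent u v -> adjacent v u.
Proof. by case=> n cuv; split; [move/esym|rewrite setUC]. Qed.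

Lemma adj_neq u v : adjacent u v -> u <> v. Proof. by case. Qed.

Lemma square_rot a b c d : square a b c d -> square b c d a.
Proof.
move=> [cS [ac bd] [ab bc] [cd da]]; split; [|split|split|split] => //.
- by rewrite (_ : [set b; c; d; a] = [set a; b; c; d]) //; apply/seteqP; split=> x /=; tauto.
- by move/esym.
Qed.

Lemma square_refl a b c d : square a b c d -> square a d c b.
Proof.
move=> [cS [ac bd] [ab bc] [cd da]]; split; [|split|split; apply: adjC|split; apply: adjC] => //.
- by rewrite (_ : [set a; d; c; b] = [set a; b; c; d]) //; apply/seteqP; split=> x /=; tauto.
- by move/esym.
Qed.

Lemma square_adj a b c d : square a b c d ->
  [/\ adjacent a b, adjacent b c, adjacent c d & adjacent d a].
Proof. by case=> _ _ [? ?] [? ?]. Qed.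

Lemma square_neq a b c d : square a b c d -> a <> c /\ b <> d.
Proof. by case. Qed.

Definition chart n (p : {ffun 'I_n -> bool} -> X) C :=
  [/\ injective p, range p = C &
      forall D, D `<=` C -> (cube D <-> exists F, cube_face F /\ D = p @` F)].

Lemma chartP C : cube C -> exists n p, @chart n p C.
Proof. exact: cube_chart. Qed.

Section Chart.
Variables (n : nat) (p : {ffun 'I_n -> bool} -> X) (C : set X).
Hypothesis ch : chart p C.
Implicit Types (x y : {ffun 'I_n -> bool}) (i j : 'I_n).

Let p_inj : injective p. Proof. by case: ch. Qed.

Lemma chart_in x : C (p x).
Proof. by case: ch => _ <- _; exists x. Qed.

Lemma chart_onto v : C v -> exists x, v = p x.
Proof. by case: ch => _ <- _ [x _ <-]; exists x. Qed.

Lemma chart_face (D : {set 'I_n}) x :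
  cube (p @` [set y : {ffun 'I_n -> bool} | forall i, i \in D -> y i = x i]).
Proof.
case: ch => _ e /(_ (p @` [set y : {ffun 'I_n -> bool} | forall i, i \in D -> y i = x i])) h.
apply/h; first by rewrite -e; apply: image_subset.
by eexists; split; last reflexivity; exists D, x.
Qed.

Lemma chart_adj x i : adjacent (p x) (p (flipc x i)).
Proof.
split=> [/p_inj e|]; first exact: (flipc_neq (esym e)).
have := chart_face (~: [set i])%SET x.
congr cube; apply/seteqP; split=> u /=.
  move=> [y yx <-]; case: (eqVneq (y i) (x i)) => yi; [left|right].
    congr p; apply/ffunP => j; case: (eqVneq j i) => [->//|ji].
    by apply: yx; rewrite !inE.
  congr p; apply/ffunP => j; rewrite ffunE; case: (eqVneq j i) => [->|ji].
    by move: yi; case: (y i) (x i) => [] [].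
  by rewrite addbF; apply: yx; rewrite !inE.
move=> [->|->]; first by exists x.
by exists (flipc x i) => // j; rewrite !inE => /negbTE ji; rewrite ffunE ji addbF.
Qed.

Lemma chart_adjE x v : C v -> adjacent (p x) v -> exists i, v = p (flipc x i).
Proof.
move=> /chart_onto[y ->] [xy cxy]; have [_ e h] := ch.
have {h} /h[/(_ cxy)+ _] : [set p x; p y] `<=` C.
  by move=> _ [->|->]; apply: chart_in.
move=> [_ [[D [z ->]] eF]].
have inF t : [set p x; p y] (p t) <-> forall i, i \in D -> t i = z i.
  by rewrite eF; split=> [[t' ht' /p_inj<-]//|ht]; exists t.
have xz := (inF x).1 (or_introl erefl); have yz := (inF y).1 (or_intror erefl).
have /existsP[i xyi] : [exists i, x i != y i].
  rewrite -[X in is_true X]negbK negb_exists; apply/negP => /forallP h; apply: xy; congr p.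
  by apply/ffunP => i; have := h i; rewrite negbK => /eqP.
have : [set p x; p y] (p (flipc x i)).
  apply/inF => j jD; rewrite ffunE xz //.
  case: eqVneq => [ji|]; last by rewrite addbF.
  by move: xyi; rewrite -ji xz // yz // eqxx.
by move=> [/p_inj/flipc_neq//|<-]; exists i.
Qed.

Lemma chart_square x i j : i <> j ->
  square (p x) (p (flipc x i)) (p (flipc (flipc x i) j)) (p (flipc x j)).
Proof.
move=> ij; have ji : j == i = false by apply/eqP => /esym.
split.
- have := chart_face (~: [set i; j])%SET x.
  congr cube; apply/seteqP; split=> u /=.
    move=> [y yx <-].
    have y' k : k != i -> k != j -> y k = x k.
      by move=> ki kj; apply: yx; rewrite !inE negb_or ki.
    suff : [\/ y = x, y = flipc x i, y = flipc (flipc x i) j | y = flipc x j].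
      by case=> ->; tauto.
    have E (z : {ffun 'I_n -> bool}) : y i = z i -> y j = z j ->
        (forall k, k != i -> k != j -> x k = z k) -> y = z.
      move=> zi zj zk; apply/ffunP => k.
      have [->//|ki] := eqVneq k i; have [->//|kj] := eqVneq k j.
      by rewrite y' ?zk.
    have [yi|yi] := eqVneq (y i) (x i); have [yj|yj] := eqVneq (y j) (x j).
    + by apply: Or41; apply: E.
    + apply: Or44; apply: E => [||k ki kj]; rewrite ?ffunE ?eqxx ?(eq_sym i) ?ji ?addbF //.
        by move: yj; case: (y j) (x j) => [] [].
      by rewrite (negbTE kj) addbF.
    + apply: Or42; apply: E => [||k ki kj]; rewrite ?ffunE ?eqxx ?ji ?addbF //.
        by move: yi; case: (y i) (x i) => [] [].
      by rewrite (negbTE ki) addbF.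
    + apply: Or43; apply: E => [||k ki kj]; rewrite ?ffunE ?eqxx ?(eq_sym i) ?ji ?addbF //.
      * by move: yi; case: (y i) (x i) => [] [].
      * by move: yj; case: (y j) (x j) => [] [].
      * by rewrite (negbTE ki) (negbTE kj) !addbF.
  have F (y : {ffun 'I_n -> bool}) : (forall k, k != i -> k != j -> y k = x k) ->
      (p @` [set y : {ffun 'I_n -> bool} | forall k, k \in (~: [set i; j])%SET -> y k = x k]) (p y).
    by move=> h; exists y => // k; rewrite !inE negb_or => /andP[]; apply: h.
  move=> [[[]|]|] ->; apply: F => // k ki kj; rewrite !ffunE.
  + by rewrite (negbTE ki) addbF.
  + by rewrite (negbTE ki) (negbTE kj) !addbF.
  + by rewrite (negbTE kj) addbF.
- split=> /p_inj.
    by move/ffunP/(_ i); rewrite !ffunE eqxx [i == j]eq_sym ji; case: (x i).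
  by move/flipc_inj.
- by split; apply: chart_adj.
- split.
  + by apply: adjC; rewrite flipcC; apply: chart_adj.
  + exact/adjC/chart_adj.
Qed.

End Chart.

Lemma cube_sub C D v : cube C -> cube D -> C v -> D v ->
  (forall u, C u -> adjacent v u -> D u) -> C `<=` D.
Proof.
move=> cC cD Cv Dv CD.
have cI : cube (C `&` D) by apply: cube_inter => //; exists v.
have [n [p ch]] := chartP cC.
have [a va] := chart_onto ch Cv; subst v.
have [pi _ /(_ _ (@subIsetl _ C D))[+ _]] := ch.
move=> /(_ cI) [_ [[E [z ->]] eF]].
suff E0 i : i \notin E.
  move=> u /(chart_onto ch)[x ->]; suff [] : (C `&` D) (p x) by [].
  by rewrite eF; exists x => // i; rewrite (negbTE (E0 i)).
apply/negP => iE.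
have /= zE t : (C `&` D) (p t) -> t i = z i.
  by rewrite eF => -[t' ht' /pi <-]; apply: ht'.
have ai := zE a (conj Cv Dv).
have : (C `&` D) (p (flipc a i)).
  split; first exact: (chart_in ch).
  by apply: CD; [exact: (chart_in ch)|exact: (chart_adj ch)].
by move/zE; rewrite ffunE eqxx -ai addbT; case: (a i).
Qed.

Lemma square_link v u c w : square v u c w ->
  forall x, [set v; u; c; w] x -> adjacent v x -> x = u \/ x = w.
Proof.
move=> sq; have [cS [vc uw] [vu uc] [cw wv]] := sq.
have [n [p ch]] := chartP cS.
have pi : injective p by case: ch.
have [a va] := chart_onto ch (or_introl (or_introl (or_introl erefl)) : [set v; u; c; w] v).
subst v.
have [i ui] := chart_adjE ch (or_introl (or_introl (or_intror erefl)) : [set p a; u; c; w] u) vu.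
have [j wj] := chart_adjE ch (or_intror erefl : [set p a; u; c; w] w) (adjC wv).
subst u w.
have ij : i <> j by move=> e; apply: uw; rewrite e.
move=> x Cx /(chart_adjE ch Cx)[k xk]; rewrite xk in Cx *.
case: Cx => [[[/pi/flipc_neq//|]|ck]|]; [by left| |by right].
have := chart_in ch (flipc (flipc a i) j); rewrite -ck => -[[[]|]|] /pi.
- move/ffunP/(_ j); rewrite !ffunE eqxx.
  by case: (eqVneq j i) => [/esym//|_]; case: (a j).
- by move/flipc_neq.
- move/ffunP => h; have := h i; have := h j; rewrite !ffunE !eqxx.
  case: (eqVneq j i) => [/esym//|_]; case: (eqVneq i j) => [//|_].
  case: (eqVneq j k) => [<-|_]; last by case: (a j).
  by case: (eqVneq i j) => [//|_]; case: (a i).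
- by rewrite flipcC => /flipc_neq.
Qed.

Lemma square_uniq v u c c' w : square v u c w -> square v u c' w -> c = c'.
Proof.
move=> sq sq'; have [cS [vc uw] [vu uc] [cw wv]] := sq.
have [cS' _ _] := sq'.
have : [set v; u; c'; w] c.
  apply: (cube_sub cS cS' (v := v)); try by rewrite /=; tauto.
  by move=> x xC /(square_link sq xC) [->|->]; rewrite /=; tauto.
case=> [[[e|e]|]|] //; first by case: vc.
- by case: (adj_neq uc).
- by move=> e; case: (adj_neq cw).
Qed.

Definition lk v u w := exists c, square v u c w.

Lemma lkC v u w : lk v u w -> lk v w u.
Proof. by case=> c /square_refl; exists c. Qed.

Lemma cube_lk C v u w : cube C -> C v -> C u -> C w ->
  adjacent v u -> adjacent v w -> u <> w -> exists c, C c /\ square v u c w.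
Proof.
move=> cC Cv Cu Cw vu vw uw.
have [n [p ch]] := chartP cC.
have [a va] := chart_onto ch Cv; subst v.
have [i ui] := chart_adjE ch Cu vu; have [j wj] := chart_adjE ch Cw vw; subst.
have ij : i <> j by move=> e; apply: uw; rewrite e.
exists (p (flipc (flipc a i) j)); split; first exact: (chart_in ch).
exact: (chart_square ch).
Qed.

Lemma cube_nbrs C v : cube C -> C v ->
  exists s : seq X, uniq s /\ forall u, u \in s <-> C u /\ adjacent v u.
Proof.
move=> cC Cv; have [n [p ch]] := chartP cC.
have [a va] := chart_onto ch Cv; subst v.
have pi : injective p by case: ch.
exists [seq p (flipc a i) | i <- enum 'I_n]; split.
  by rewrite map_inj_uniq ?enum_uniq // => i j /pi/flipc_inj.
move=> u; split.
  by move=> /mapP[i _ ->]; split; [exact: (chart_in ch)|exact: (chart_adj ch)].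
case=> Cu /(chart_adjE ch Cu)[i ->].
by apply/mapP; exists i => //; rewrite mem_enum.
Qed.

End CubeStructure.

Section Flag.
Variable X : cubeComplex.
Implicit Types (a b c d u v w : X) (C D : set X).
Hypothesis X_flag : forall v : X, flag_link v.

Lemma flag_cube v (s : seq X) :
  (forall u, u \in s -> adjacent v u) ->
  (forall u w, u \in s -> w \in s -> u <> w -> lk v u w) ->
  exists C, [/\ cube C, C v & forall u, u \in s <-> C u /\ adjacent v u].
Proof.
move=> vs slk; have := @X_flag v [set` s] (finite_seq s).
case=> [u w /= us ws|C [cC Cv e]]; last first.
  exists C; split=> // u.
  have -> : (u \in s) = [set` s] u :> Prop by [].
  by rewrite e.
have [uw|uw] := pselect (u = w).
  subst w; exists [set v; u]; have [vu cvu] := vs u us; split=> //; first by left.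
  apply/seteqP; split=> x /=.
    by case=> ->; split; [right|exact: vs|right|exact: vs].
  by case=> -[->[]//|->] _; left.
have [c sq] := slk u w us ws uw; have [cS _ _] := sq.
exists [set v; u; c; w]; split=> //; first by left; left; left.
apply/seteqP; split=> x /=.
  by case=> ->; split; try exact: vs; tauto.
by case=> xC /(square_link sq xC).
Qed.

Lemma cube3 w z x x' v y t :
  square w z v x -> square w z y x' -> square w x t x' ->
  exists s, [/\ square z v s y, square v x t s & square y x' t s].
Proof.
move=> s1 s2 s3.
have [wz zv vx xw] := square_adj s1; have [_ zy yx x'w] := square_adj s2.
have [_ xt tx' _] := square_adj s3.
have [n1 zx] := square_neq s1; have [n2 zx'] := square_neq s2.
have [n3 xx'] := square_neq s3.
have [||C [cC Cw Cs]] := @flag_cube w [:: z; x; x'].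
- by move=> u; rewrite !inE => /or3P[]/eqP->//; apply: adjC.
- have l1 : lk w z x by exists v.
  have l2 : lk w z x' by exists y.
  have l3 : lk w x x' by exists t.
  by move=> u u'; rewrite !inE => /or3P[]/eqP-> /or3P[]/eqP-> //_; apply: lkC.
have [n [p ch]] := chartP cC.
have [a wa] := chart_onto ch Cw; subst w.
have pi : injective p by case: ch.
have [] : [/\ C z, C x & C x'].
  by split; [case: (Cs z)|case: (Cs x)|case: (Cs x')] => + _;
     rewrite !inE eqxx ?orbT => /(_ isT)[].
move=> /(chart_adjE ch)/(_ wz)[i zi] /(chart_adjE ch)/(_ (adjC xw))[j xj].
move=> /(chart_adjE ch)/(_ (adjC x'w))[k x'k]; subst z x x'.
have ij : i <> j by move=> e; apply: zx; rewrite e.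
have ik : i <> k by move=> e; apply: zx'; rewrite e.
have jk : j <> k by move=> e; apply: xx'; rewrite e.
have ev := square_uniq s1 (chart_square ch a ij).
have ey := square_uniq s2 (chart_square ch a ik).
have et := square_uniq s3 (chart_square ch a jk); subst v y t.
exists (p (flipc (flipc (flipc a i) j) k)); split.
- exact: (chart_square ch).
- have := chart_square ch (flipc a j) ik.
  by rewrite (flipcC a j i) => /square_rot/square_refl.
- have := chart_square ch (flipc a k) ij.
  rewrite (flipcC a k i) (flipcC a k j) (flipcC (flipc a i) k j).
  by move=> /square_rot/square_refl.
Qed.

End Flag.

(** * Edge-paths up to moves across squares *)

(* In this part a path is the sequence of all its vertices, listed from the
   moving endpoint (the tip) back to the fixed one. *)

Section Flips.
Variable X : cubeComplex.
Implicit Types (a b c d u v w x y z : X) (p q r : seq X).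

Inductive flip : seq X -> seq X -> Prop :=
| flip_nil p : flip p p
| flip_cons z p q : flip p q -> flip (z :: p) (z :: q)
| flip_square a b c d t : square a b c d ->
    flip (a :: b :: c :: t) (a :: d :: c :: t)
| flip_trans q p r : flip p q -> flip q r -> flip p r.

Lemma flip_sym p q : flip p q -> flip q p.
Proof.
elim=> {p q} [p|z p q _ h|a b c d t /square_refl sq|q p r _ h _ h'].
- exact: flip_nil.
- exact: flip_cons.
- exact: flip_square.
- exact: flip_trans h.
Qed.

Lemma flip_size p q : flip p q -> size p = size q.
Proof. by elim=> {p q} //= [z p q _ ->//|q p r _ -> _ ->]. Qed.

Lemma flip_head z p q : flip p q -> head z p = head z q.
Proof. by elim=> {p q} // q p r _ -> _ ->. Qed.

Lemma flip_last z p q : flip p q -> last z p = last z q.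
Proof.
move=> h; elim: h z => {p q} //= q p r _ h _ h' z.
by rewrite h.
Qed.

Fixpoint nobt p : bool :=
  if p is a :: p' then (if p' is _ :: c :: _ then a != c else true) && nobt p'
  else true.

Definition red p := forall q, flip p q -> nobt q.

Definition desc y p := exists z q, flip p (z :: y :: q).

Lemma red_nobt p : red p -> nobt p. Proof. by apply; apply: flip_nil. Qed.

Lemma red_flip p q : flip p q -> red p -> red q.
Proof. by move=> pq rp r qr; apply: rp; apply: flip_trans qr. Qed.

Lemma red_tail y p : red (y :: p) -> red p.
Proof. by move=> rp q pq; have /andP[] := rp _ (flip_cons y pq). Qed.

Lemma red_ndesc y p : red (y :: p) -> ~ desc y p.
Proof.
move=> rp [z [q pq]]; have := red_nobt (red_flip (flip_cons y pq) rp).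
by rewrite /= eqxx.
Qed.

Lemma desc_flip y p q : flip p q -> desc y p -> desc y q.
Proof.
by move=> pq [z [r h]]; exists z, r; apply: flip_trans h; apply: flip_sym.
Qed.

Hypothesis X_flag : forall v : X, flag_link v.

(* Transitivity of this relation on paths of a given length is where the link
   condition enters, through [cube3]. *)
Definition tip_related p q : Prop :=
  match p, q with
  | z :: v :: p', z' :: w :: q' =>
      z = z' /\ ((v = w /\ flip (v :: p') (w :: q')) \/
        exists x r, [/\ square z v x w, flip (v :: p') (v :: x :: r) &
                        flip (w :: q') (w :: x :: r)])
  | _, _ => True
  end.

Lemma flip_tip p q : flip p q -> tip_related p q.
Proof.
move: {2}(size p) (leqnn (size p)) => n; elim: n p q => [|n IH] p q.
  by case: p.
move=> sp h; elim: h sp => {p q} [|z p q pq _ _|a b c d t sq _|q p r pq h qr h' sp].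
- by case=> [|z [|v p]] //= _; split=> //; left; split=> //; apply: flip_nil.
- case: p q pq => [|v p] [|w q] //= pq; split=> //; left; split=> //.
  by have /= := flip_head v pq.
- by split=> //; right; exists c, t; split=> //; apply: flip_nil.
have := h' (etrans (congr1 (fun k => k <= n.+1) (esym (flip_size pq))) sp).
move: {h h'} (h sp).
case: p q r pq qr sp => [|z [|v p]] [|z1 [|w q]] [|z2 [|y o]] //;
  try by move=> /flip_size //= ? /flip_size /=.
move=> pq qr sp; rewrite /tip_related.
move=> [<-{z1 pq qr} D1] [<-{z2} D2]; split=> //.
case: D1 => [[-> vw]|[x [r [s1 vp wq]]]].
  case: D2 => [[<- wy]|[x [r [s2 wq yo]]]].
    by left; split=> //; apply: flip_trans wy.
  by right; exists x, r; split=> //; apply: flip_trans wq.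
case: D2 => [[<- wy]|[x' [r' [s2 wq' yo]]]].
  by right; exists x, r; split=> //; apply: flip_trans wq; apply: flip_sym.
have : flip (w :: x :: r) (w :: x' :: r') /\ size (w :: x :: r) <= n.
  split; first by apply: flip_trans wq'; apply: flip_sym.
  by have /= := flip_size vp; move: sp => /=; lia.
have s1' := square_rot (square_rot (square_rot s1)).
have s2' := square_refl (square_rot s2).
move=> [/IH h /h{h}] [_ [[ex xr]|[t [o' [s3 xr xr']]]]].
  subst x'; have [vy|vy] := pselect (v = y).
    subst y; left; split=> //; apply: flip_trans vp _.
    by apply: flip_trans (flip_sym yo); apply: flip_cons.
  by case: vy; apply: square_uniq s1' s2'.
have [s [t1 t2 t3]] := cube3 X_flag s1' s2' s3.
right; exists s, (t :: o'); split=> //.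
- apply: flip_trans vp _; apply: flip_trans (flip_square _ t2).
  exact: flip_cons.
- apply: flip_trans yo _; apply: flip_trans (flip_square _ t3).
  exact: flip_cons.
Qed.
End Flips.

Section Lifting.
Variable X : cubeComplex.
Hypothesis X_flag : forall v : X, flag_link v.
Implicit Types (a b c d u v w x y z : X) (p q r l : seq X).

Lemma flip_cancel z y p q :
  flip (z :: y :: p) (z :: y :: q) -> flip (y :: p) (y :: q).
Proof.
by move=> /(flip_tip X_flag)[_ [[]//|[x [r [/square_neq[_]]]]]].
Qed.

Lemma red_cons y p : red p -> ~ desc y p -> red (y :: p).
Proof.
move: {2}(size p) (leqnn (size p)) => n; elim: n y p => [|n IH] y p sp rp nd o yo.
  case: p sp yo {rp nd} => // _ /flip_size /=; by case: o => [|? []].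
case: p sp rp nd yo => [|z p] sp rp nd yo.
  by move/flip_size: yo => /=; case: o => [|? []].
have := flip_tip X_flag yo; case: o yo => [|y' [|w q]] //= yo [<-{y' yo}].
case=> [[<- pq]|[x [r [sq pr wq]]]].
  apply/andP; split; last exact: rp _ pq.
  case: q pq => [|y'' q] // pq; apply/eqP => e; apply: nd.
  by exists z, q; rewrite e.
have rxr : red (x :: r) by apply: red_tail (red_flip pr rp).
have nwx : ~ desc w (x :: r).
  move=> [x' [r' xr]]; have e := flip_head x xr; rewrite /= in e; subst x'.
  apply: nd; exists z, (w :: r').
  apply: flip_trans pr _; apply: flip_trans (flip_cons z xr) _.
  exact/flip_square/(square_rot sq).
have rwq : red (w :: q).
  apply: red_flip (flip_sym wq) _; apply: IH => //.
  by have := flip_size pr; move: sp => /=; lia.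
apply/andP; split; last exact: red_nobt rwq.
case: q wq rwq => [|y' q] // wq rwq; apply/eqP => e; subst y'.
have [zw yx] := square_neq sq.
have [_ [[]//|[t [r' [sq' yq xr]]]]] := flip_tip X_flag wq.
have e := square_uniq (square_rot (square_rot (square_rot sq))) sq'; subst t.
have := red_nobt (red_flip (flip_trans pr (flip_cons z xr)) rp).
by rewrite /= eqxx.
Qed.

Definition act y p : seq X :=
  if pselect (desc y p) is left h then y :: projT1 (cid (projT2 (cid h)))
  else y :: p.

Lemma actP y p : (exists z q, flip p (z :: y :: q) /\ act y p = y :: q) \/
  ~ desc y p /\ act y p = y :: p.
Proof.
rewrite /act; case: pselect => h; last by right.
by left; exists (projT1 (cid h)); case: (cid (projT2 (cid h))) => /= q pq; exists q.
Qed.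

Lemma act_desc y p z q : flip p (z :: y :: q) -> flip (act y p) (y :: q).
Proof.
move=> pq; have [[z' [q' [pq' ->]]]|[[]]] := actP y p; last by exists z, q.
have zq := flip_trans (flip_sym pq') pq.
by have /= e := flip_head z zq; subst z'; apply: flip_cancel zq.
Qed.

Lemma act_ndesc y p : ~ desc y p -> act y p = y :: p.
Proof.
by have [[z [q [pq _]]] []|[_ ->]//] := actP y p; exists z, q.
Qed.

Lemma act_flip y p q : flip p q -> flip (act y p) (act y q).
Proof.
move=> pq; have [[z [r [pr _]]]|[nd ->]] := actP y p.
  apply: flip_trans (act_desc pr) _; apply/flip_sym/(@act_desc _ _ z).
  exact: flip_trans (flip_sym pq) pr.
rewrite act_ndesc; first exact: flip_cons.
by move/(desc_flip (flip_sym pq)).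
Qed.

Lemma act_red y p : red p -> red (act y p).
Proof.
move=> rp; have [[z [q [pq ->]]]|[nd ->]] := actP y p; last exact: red_cons.
exact: red_tail (red_flip pq rp).
Qed.

Lemma act_head y p : exists q, act y p = y :: q.
Proof. by have [[z [q [_ ->]]]|[_ ->]] := actP y p; eexists. Qed.

Lemma act_backtrack y z p : red (z :: p) -> flip (act z (act y (z :: p))) (z :: p).
Proof.
move=> rp; have [[z' [q [pq ->]]]|[nd ->]] := actP y (z :: p); last first.
  by apply: (@act_desc _ _ y); apply: flip_nil.
have /= e := flip_head z pq; subst z'.
rewrite act_ndesc; first exact: flip_sym.
by apply: red_ndesc; apply: red_flip rp.
Qed.

Lemma act_square a b c d p : square a b c d ->
  flip (act c (act b (a :: p))) (act c (act d (a :: p))).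
Proof.
move=> sq0.
have main b' d' : square a b' c d' -> desc b' (a :: p) ->
    flip (act c (act b' (a :: p))) (act c (act d' (a :: p))).
  move=> sq [z [q h]]; have /= e := flip_head z h; subst z.
  apply: flip_trans (act_flip _ (act_desc h)) _.
  have [[z [q' h']]|nd] := pselect (desc d' (a :: p)).
    have /= e := flip_head z h'; subst z; apply: flip_sym.
    apply: flip_trans (act_flip _ (act_desc h')) _.
    have hh := flip_trans (flip_sym h) h'.
    have [_ [[e _]|[x [r [sq' h1 h2]]]]] := flip_tip X_flag hh.
      by case: (square_neq sq).
    have e := square_uniq sq sq'; subst x.
    by apply: flip_trans (act_desc h2) _; apply/flip_sym/(act_desc h1).
  rewrite (act_ndesc nd) act_ndesc; last first.
    move=> [z [r h1]]; have /= e := flip_head z h1; subst z; apply: nd.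
    exists a, (c :: r); apply: flip_trans h _.
    apply: flip_trans (flip_cons a h1) _; exact: flip_square.
  apply/flip_sym/(@act_desc _ _ d' (b' :: q)); apply: flip_trans (flip_cons d' h) _.
  exact/flip_square/square_rot/square_rot/square_rot.
have [|nb] := pselect (desc b (a :: p)); first exact: main.
have [dd|nd] := pselect (desc d (a :: p)).
  by apply/flip_sym/main => //; apply: square_refl.
have ndc b' d' : square a b' c d' -> ~ desc d' (a :: p) -> ~ desc c (b' :: a :: p).
  move=> sq ndd [z [q h]]; have /= e := flip_head z h; subst z.
  have [_ [[e _]|[x [r [sq' h1 _]]]]] := flip_tip X_flag h.
    by case: (square_neq sq).
  have e := square_uniq (square_rot (square_refl (square_rot (square_rot sq)))) sq'; subst x.
  by apply: ndd; exists a, r.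
rewrite (act_ndesc nb) (act_ndesc nd) !act_ndesc.
- by apply/flip_square; do 2 apply/square_rot; apply: square_refl.
- exact: ndc (square_refl sq0) nb.
- exact: ndc sq0 nd.
Qed.

Definition lift l := foldr act [::] l.

Lemma lift_red l : red (lift l).
Proof.
elim: l => [|y l]; last exact: act_red.
by move=> q /flip_size; case: q.
Qed.

Lemma lift_homotopy l l' : homotopic l l' -> flip (lift l) (lift l').
Proof.
elim=> {l l'} [_ _ [s u v t uv|s a b c d t sq]|l|l l' _ h|l l' l'' _ h _ h'].
- rewrite /lift !foldr_cat; elim: s => [|y s] /=; last exact: act_flip.
  have := @lift_red (u :: t); rewrite /lift /=.
  by have [q ->] := act_head u (foldr act [::] t); apply: act_backtrack.
- rewrite /lift !foldr_cat; elim: s => [|y s] /=; last exact: act_flip.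
  have [q ->] := act_head c (foldr act [::] t).
  by apply: act_square; do 2 apply/square_rot; apply: square_refl.
- exact: flip_nil.
- exact: flip_sym.
- exact: flip_trans h'.
Qed.

Lemma red_lift l : red l -> flip (lift l) l.
Proof.
elim: l => [_|y l IH rl]; first exact: flip_nil.
have h := IH (red_tail rl).
rewrite /lift /= -/(lift l) act_ndesc; first exact: flip_cons.
by move/(desc_flip h); apply: red_ndesc.
Qed.

Lemma red_homotopic l l' : red l -> red l' -> homotopic l l' -> flip l l'.
Proof.
move=> rl rl' /lift_homotopy h; apply: flip_trans (flip_sym (red_lift rl)) _.
exact: flip_trans h (red_lift rl').
Qed.

Hypothesis X_sc : simply_connected X.

Definition walk := sorted (fun x y : X => `[< adjacent x y >]).

Lemma walk_rev l : walk (rev l) = walk l.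
Proof.
rewrite /walk rev_sorted; apply: eq_sorted => x y.
by apply/asboolP/asboolP; apply: adjC.
Qed.

Lemma homotopic_cat s l l' t : homotopic l l' -> homotopic (s ++ l ++ t) (s ++ l' ++ t).
Proof.
elim=> {l l'} [_ _ [s1 u v t1 uv|s1 a b c d t1 sq]|l|l l' _ h|l l' l'' _ h _ h'].
- rewrite -!catA; apply: rst_step; rewrite !(catA s).
  exact: (@backtrack _ (s ++ s1) u v (t1 ++ t)).
- rewrite -!catA; apply: rst_step; rewrite !(catA s).
  exact: (@across_square _ (s ++ s1) a b c d (t1 ++ t)).
- exact: rst_refl.
- exact: rst_sym.
- exact: rst_trans h'.
Qed.

Lemma homotopic_retrace z q t : walk (z :: q) ->
  homotopic (z :: q ++ behead (rev (z :: q)) ++ t) (z :: t).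
Proof.
elim: q z t => [|y q IH] z t; first by rewrite /= /rev /=; move=> _; apply: rst_refl.
move=> /= /andP[/asboolP zy wq].
have -> : behead (rev [:: z, y & q]) = rcons (behead (rev (y :: q))) z.
  by rewrite rev_cons; have := size_rev (y :: q); case: (rev (y :: q)).
rewrite cat_rcons; apply: rst_trans.
  by have := homotopic_cat [:: z] [::] (IH y (z :: t) wq); rewrite !cats0; apply.
by apply: rst_step; apply: (@backtrack _ [::] z y t).
Qed.

Lemma walks_homotopic z p q : walk (z :: p) -> walk (z :: q) ->
  last z p = last z q -> homotopic (z :: p) (z :: q).
Proof.
move=> wp wq e.
pose u := last z q; pose L := behead (rev (z :: q)) ++ p.
have revE : rev (z :: q) = u :: behead (rev (z :: q)).
  by rewrite /u [z :: q]lastI rev_rcons.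
have wL : edge_path u L.
  have := wq; rewrite -walk_rev revE /edge_path /L cat_path => /= ->.
  have -> : last u (behead (rev (z :: q))) = z.
    by rewrite -(last_cons u) -revE rev_cons last_rcons.
  exact: wp.
have lL : last u L = u.
  rewrite /L last_cat (_ : last u (behead (rev (z :: q))) = z) //.
  by rewrite -(last_cons u) -revE rev_cons last_rcons.
have := homotopic_cat (belast z q) [::] (X_sc.2 u L wL lL).
rewrite !cats0 cats1 -lastI -(cat_rcons u _ L) -lastI => h.
exact: (rst_trans _ _ _ _ _ (rst_sym _ _ _ _ (homotopic_retrace _ wq)) h).
Qed.

End Lifting.

(** * The graph metric *)

Section Distance.
Variable X : cubeComplex.
Implicit Types (a b c t u v w x y z : X) (p q r l : seq X).

Definition joined u v n : bool :=
  `[< exists p, [/\ edge_path u p, last u p = v & size p = n] >].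

Definition dist u v : nat :=
  if pselect (exists n, joined u v n) is left h then ex_minn h else 0.

Lemma flip_walk p q : flip p q -> walk p -> walk q.
Proof.
elim=> {p q} // [z p q pq h|a b c d t sq|q p r _ h _ h' /h/h'//].
  case: p q pq h => [|x p] [|y q] //; try by move=> /flip_size.
  by move=> /(flip_head x) /= -> h /andP[-> /h].
have [ab bc cd da] := square_adj sq.
by move=> /and3P[_ _ wt]; apply/and3P; split=> //; apply/asboolP; apply: adjC.
Qed.

Lemma dist_min u p : edge_path u p -> dist u (last u p) <= size p.
Proof.
move=> up; rewrite /dist; case: pselect => // h.
by case: ex_minnP => m _; apply; apply/asboolP; exists p.
Qed.

Hypothesis X_CAT0 : CAT0 X.
Let X_flag : forall v, flag_link v := X_CAT0.2.
Let X_sc : simply_connected X := X_CAT0.1.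

Lemma dist_geodesic u v :
  exists p, [/\ edge_path u p, last u p = v & size p = dist u v].
Proof.
rewrite /dist; case: pselect => [h|[]].
  by case: ex_minnP => m /asboolP[p ?] _; exists p.
by have [p [up pv]] := X_sc.1 u v; exists (size p); apply/asboolP; exists p.
Qed.

Lemma distxx u : dist u u = 0.
Proof. by have := @dist_min u [::] isT; rewrite leqn0 => /eqP. Qed.

Lemma dist_eq0 u v : dist u v = 0 -> u = v.
Proof. by have [p [_ <- <-]] := dist_geodesic u v; case: p. Qed.

Lemma dist_le_sym u v : dist u v <= dist v u.
Proof.
have [p [vp <- <-]] := dist_geodesic v u.
have e : rev (v :: p) = last v p :: behead (rev (v :: p)).
  by rewrite [v :: p]lastI rev_rcons.
have : edge_path (last v p) (behead (rev (v :: p))).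
  have : walk (rev (v :: p)) by rewrite walk_rev.
  by rewrite e.
move/dist_min; rewrite size_behead size_rev /=.
rewrite (_ : last _ (behead _) = v) //.
by rewrite -(last_cons v) -e rev_cons last_rcons.
Qed.

Lemma distC u v : dist u v = dist v u.
Proof. by apply/eqP; rewrite eqn_leq !dist_le_sym. Qed.

Lemma dist_tri v u w : dist u w <= dist u v + dist v w.
Proof.
have [p [up ev <-]] := dist_geodesic u v; have [q [vq ew <-]] := dist_geodesic v w.
have := @dist_min u (p ++ q); rewrite last_cat ev ew size_cat; apply.
by rewrite /edge_path cat_path up ev.
Qed.

Lemma dist_adj u v : adjacent u v -> dist u v = 1.
Proof.
move=> uv; have := @dist_min u [:: v]; rewrite /edge_path /= andbT.
move=> /(_ (asboolT uv)).
by case: (dist u v) (@dist_eq0 u v) => [/(_ erefl)/(adj_neq uv)|[]].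
Qed.

Lemma dist_step u v n : dist u v = n.+1 -> exists w, adjacent u w /\ dist w v = n.
Proof.
have [p [up pv sp']] := dist_geodesic u v => sp; rewrite sp in sp'.
case: p sp' up pv => [|w p] // [sp'] /andP[/asboolP uw wp] /= pv; exists w; split=> //.
have := @dist_tri w u v; have := dist_min wp.
by rewrite (dist_adj uw) pv; lia.
Qed.

Lemma geodesic_red u p : edge_path u p -> size p = dist u (last u p) -> red (u :: p).
Proof.
move=> up sp q upq; have wq := flip_walk upq up.
have /= sq := flip_size upq; have lq := flip_last u upq.
have hd := flip_head u upq; clear upq; case: q hd wq sq lq => // _ q /= <- wq [sq] lq.
have {}sq : size q <= dist u (last u q) by rewrite -sq sp lq.
elim: q u wq sq {lq sp up} => [//|x q IH] u /= /andP[/asboolP ux xq] sq.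
have hq : size q <= dist x (last x q).
  by have := dist_tri x u (last x q); rewrite (dist_adj ux); lia.
rewrite IH // andbT; case: q xq sq {IH hq} => // y q /= /andP[_ yq] sq.
apply/eqP => e; subst y.
by have := dist_min yq; lia.
Qed.

Lemma reds_flip z p q : edge_path z p -> edge_path z q -> last z p = last z q ->
  red (z :: p) -> red (z :: q) -> flip (z :: p) (z :: q).
Proof.
by move=> zp zq e rp rq; apply: red_homotopic => //; apply: walks_homotopic.
Qed.

Lemma dist_adj_neq x a b : adjacent a b -> dist a x <> dist b x.
Proof.
move=> ab e.
have [p [ap px sp]] := dist_geodesic a x; have [q [bq qx sq]] := dist_geodesic b x.
have rp : red (a :: p) by apply: geodesic_red; rewrite ?px.
have rq : red (b :: q) by apply: geodesic_red; rewrite ?qx.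
have [[z [r h]]|nd] := pselect (desc b (a :: p)).
  have /= ez := flip_head a h; subst z.
  have := flip_walk h ap => /= /andP[_ br].
  have := flip_last a h; have := flip_size h; rewrite /= px => -[sr] xr.
  by have := dist_min br; rewrite -xr; lia.
have rbp := red_cons X_flag rp nd.
have bap : edge_path b (a :: p) by apply/andP; split=> //; apply/asboolP/adjC.
have /flip_size := reds_flip bap bq (etrans px (esym qx)) rbp rq.
by rewrite /=; lia.
Qed.

Lemma dist_adjP x a b : adjacent a b ->
  dist a x = (dist b x).+1 \/ dist b x = (dist a x).+1.
Proof.
move=> ab; have := dist_tri b a x; have := dist_tri a b x.
by rewrite (dist_adj ab) (dist_adj (adjC ab)); have := @dist_adj_neq x _ _ ab; lia.
Qed.

Lemma quadrangle u z v w : adjacent z v -> adjacent z w -> v <> w ->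
  dist z u = (dist v u).+1 -> dist z u = (dist w u).+1 ->
  exists t, square z v t w /\ dist v u = (dist t u).+1.
Proof.
move=> zv zw vw dv dw.
have [p [vp pu sp]] := dist_geodesic v u; have [q [wq qu sq]] := dist_geodesic w u.
have zvp : edge_path z (v :: p) by apply/andP; split=> //; apply/asboolP.
have zwq : edge_path z (w :: q) by apply/andP; split=> //; apply/asboolP.
have rp : red (z :: v :: p) by apply: geodesic_red; rewrite //= pu sp.
have rq : red (z :: w :: q) by apply: geodesic_red; rewrite //= qu sq.
have h := reds_flip zvp zwq (etrans pu (esym qu)) rp rq.
have [_ [[]//|[t [r [sqr vpt _]]]]] := flip_tip X_flag h.
exists t; split=> //.
have /andP[/asboolP vt tr] : edge_path v (t :: r) := flip_walk vpt vp.
have := flip_last v vpt; have := flip_size vpt; rewrite /= pu => -[sr] ur.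
have := dist_min tr; rewrite -ur; have := dist_tri t v u; rewrite (dist_adj vt); lia.
Qed.

End Distance.

(** * Hyperplanes and carriers *)

Section Walls.
Variable X : cubeComplex.
Hypothesis X_CAT0 : CAT0 X.
Implicit Types (a b c d g t u v w x y z : X) (E F : set X) (A B C : set X).
Implicit Types H K W : hyperplane X.

Let dist_adjP := dist_adjP X_CAT0.
Let distC := distC X_CAT0.
Let dist_tri := dist_tri X_CAT0.
Let dist_adj := dist_adj X_CAT0.
Let dist_eq0 := dist_eq0 X_CAT0.
Let dist_step := dist_step X_CAT0.
Let quadrangle := quadrangle X_CAT0.

Definition near a b x := dist a x < dist b x.

Lemma nearN a b x : adjacent a b -> near b a x = ~~ near a b x.
Proof. by move=> /(dist_adjP x); rewrite /near; lia. Qed.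

Lemma near_refl a b : adjacent a b -> near a b a.
Proof. by move=> ab; rewrite /near distxx (dist_adj (adjC ab)). Qed.

Lemma near_square a b c d x : square a b c d -> near a b x -> near d c x.
Proof.
move=> sq; have [ab bc cd da] := square_adj sq; have [_ _] := square_neq sq.
have := dist_adjP x ab; have := dist_adjP x bc; have := dist_adjP x cd.
have := dist_adjP x da; rewrite /near => h1 h2 h3 h4 h5.
have [//|h6] : dist d x < dist c x \/ dist d x = (dist c x).+1 by lia.
have [] : exists t, square b a t c /\ dist a x = (dist t x).+1.
  apply: quadrangle => //; try lia; first exact: adjC.
  by have [] := square_neq sq.
move=> t [sq' e]; have := square_uniq sq' (square_refl (square_rot sq)).
by move=> et; subst t; lia.
Qed.

Definition sep E x y := exists a b,
  [/\ E = [set a; b], adjacent a b, near a b x & near b a y].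

Lemma set2_eq a b c d : [set a; b] = [set c; d] ->
  (a = c /\ b = d) \/ (a = d /\ b = c).
Proof.
move=> e.
have ha : [set c; d] a by rewrite -e; left.
have hb : [set c; d] b by rewrite -e; right.
have hc : [set a; b] c by rewrite e; left.
have hd : [set a; b] d by rewrite e; right.
by move: ha hb hc hd => /= [ea|ea] [eb|eb] [ec|ec] [ed|ed]; subst; tauto.
Qed.

Lemma sep_edge a b x y : adjacent a b -> sep [set a; b] x y <->
  (near a b x /\ near b a y) \/ (near b a x /\ near a b y).
Proof.
move=> ab; split.
  by move=> [c [d [/set2_eq[[<- <-]|[<- <-]] _ ? ?]]]; [left|right].
move=> [[? ?]|[? ?]]; first by exists a, b.
by exists b, a; split=> //; [rewrite setUC|apply: adjC].
Qed.

Lemma sep_opposite E F x y : opposite_edges E F -> sep E x y -> sep F x y.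
Proof.
move=> [a [b [c [d [sq -> ->]]]]]; have [ab bc cd da] := square_adj sq.
move=> /(sep_edge _ _ ab) h; apply/(sep_edge _ _ (adjC cd)).
have sq' := square_refl (square_rot sq).
by case: h => [[/(near_square sq) ? /(near_square sq') ?]
              |[/(near_square sq') ? /(near_square sq) ?]]; [left|right].
Qed.

Lemma opposite_edgesC E F : opposite_edges E F -> opposite_edges F E.
Proof.
move=> [a [b [c [d [sq -> ->]]]]]; exists d, c, b, a; split=> //.
exact/square_rot/square_refl.
Qed.

Lemma sep_parallel E F x y : parallel E F -> sep E x y <-> sep F x y.
Proof.
elim=> {E F} [E F h|//|E F _ h|E F G _ h _ h'].
- by split; apply: sep_opposite => //; apply: opposite_edgesC.
- exact: iff_sym h.
- exact: iff_trans h h'.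
Qed.

Lemma parallel_edge E F : parallel E F -> edge E <-> edge F.
Proof.
have half E' F' : opposite_edges E' F' -> edge E' -> edge F'.
  move=> [a [b [c [d [sq -> ->]]]]] _; exists d, c; split=> //.
  by have [_ _ /adjC] := square_adj sq.
elim=> {E F} [E F h|//|E F _ h|E F G _ h _ h'].
- by split; apply: half => //; apply: opposite_edgesC.
- exact: iff_sym h.
- exact: iff_trans h h'.
Qed.

Definition dual H a b := adjacent a b /\ val H [set a; b].

Lemma dualC H a b : dual H a b -> dual H b a.
Proof. by case=> /adjC ba; rewrite setUC. Qed.

Lemma hyp_classP H E : val H E -> edge E /\ forall F, val H F <-> parallel E F.
Proof.
have /set_mem [E0 [eE0 ->]] := valP H; rewrite /= => h; split.
  exact/(parallel_edge h).
by move=> F; split=> h'; [apply: rst_trans h'; apply: rst_sym|apply: rst_trans h'].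
Qed.

Lemma hyp_edge H E : val H E -> exists a b, E = [set a; b] /\ dual H a b.
Proof.
move=> /[dup] HE /hyp_classP[[a [b [ab e]]] _].
by exists a, b; split=> //; split=> //; rewrite -e.
Qed.

Lemma hyp_dual H : exists a b, dual H a b.
Proof.
have /set_mem [E [eE e]] := valP H.
have /hyp_edge[a [b [_ ?]]] : val H E by rewrite e; apply: rst_refl.
by exists a, b.
Qed.

Lemma dual_ex a b : adjacent a b -> exists H, dual H a b.
Proof.
move=> ab; have h : [set F | parallel [set a; b] F] \in @hyperplanes X.
  by apply/mem_set; exists [set a; b]; split=> //; exists a, b.
by exists (exist _ [set F | parallel [set a; b] F] h); split=> //; apply: rst_refl.
Qed.

Lemma dual_uniq H K a b : dual H a b -> dual K a b -> H = K.
Proof.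
move=> [_ /hyp_classP[_ h]] [_ /hyp_classP[_ k]]; apply: val_inj.
apply/seteqP; split=> F; first by move/h/k.
by move/k/h.
Qed.

Lemma dual_square H a b c d : square a b c d -> dual H a b -> dual H d c.
Proof.
move=> sq [ab /hyp_classP[_ h]]; split.
  by have [_ _ /adjC] := square_adj sq.
by apply/h/rst_step; exists a, b, c, d.
Qed.

Lemma dual_near H a b c d : dual H a b -> dual H c d -> near a b c ->
  near a b =1 near c d.
Proof.
move=> [ab Hab] [cd Hcd] nc x.
have par : parallel [set a; b] [set c; d] by have [_ h] := hyp_classP Hab; apply/h.
have S y z : sep [set a; b] y z <-> sep [set c; d] y z by apply: sep_parallel.
have nb := near_refl (adjC ab).
have dcb : near d c b.
  have /S/(sep_edge _ _ cd) : sep [set a; b] c b by apply/sep_edge => //; left.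
  by case=> [[] //|[]]; rewrite (nearN _ cd) near_refl.
apply/idP/idP => h.
  have /S/(sep_edge _ _ cd) : sep [set a; b] x b by apply/sep_edge => //; left.
  by case=> [[] //|[_]]; rewrite (nearN _ (adjC cd)) dcb.
have /S/(sep_edge _ _ ab) : sep [set c; d] x b by apply/sep_edge => //; left.
by case=> [[] //|[_]]; rewrite (nearN _ (adjC ab)) nb.
Qed.

Lemma dual_cross H a b x y : dual H a b -> adjacent x y ->
  near a b x -> near b a y -> dual H x y.
Proof.
move=> Hab; have [ab _] := Hab.
move: {2}(dist x a) (erefl (dist x a)) => k.
elim: k x y => [|k IH] x y dk xy; rewrite /near.
all: have := dist_adjP a xy; have := dist_adjP b xy.
all: have := dist_adjP x ab; have := dist_adjP y ab.
all: rewrite (distC a x) (distC a y) (distC b x) (distC b y).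
  move=> h1 h2 h3 h4 h5 h6; have -> : x = a by apply: dist_eq0.
  by have -> : y = b by apply: dist_eq0; lia.
move=> h1 h2 h3 h4 h5 h6.
have [x' [xx' dx']] := dist_step dk.
have := dist_adjP b xx'; have := dist_adjP x' ab.
rewrite (distC a x') (distC b x') => h7 h8.
have [] : exists t, square x y t x' /\ dist y b = (dist t b).+1.
  by apply: quadrangle => //; try lia; move=> e; subst x'; lia.
move=> t [sq dt].
have [_ yt tx' _] := square_adj sq.
have := dist_adjP a yt => h9.
have sq' := square_refl (square_rot (square_rot (square_rot sq))).
apply: (dual_square sq'); apply: IH => //; try exact: adjC.
  by rewrite /near (distC a) (distC b); lia.
by rewrite /near (distC a) (distC b); lia.
Qed.

Lemma dual_inj H v x y : dual H v x -> dual H v y -> x = y.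
Proof.
move=> vx vy; have [avx _] := vx; have [avy _] := vy.
have e := dual_near vx vy (near_refl avx).
have := near_refl (adjC avy); rewrite (nearN _ avy) -e /near.
by have := dist_adjP y avx; rewrite (dist_adj avy) => h h'; apply: dist_eq0; lia.
Qed.

Definition carrier H v := exists w, dual H v w.

Definition convex A := forall v w x, A v -> A w ->
  dist v x + dist x w = dist v w -> A x.

Lemma carrier_step H v w x : carrier H v -> carrier H w -> adjacent v x ->
  dist v w = (dist x w).+1 -> carrier H x.
Proof.
move=> [v' vv'] [w' ww'] vx dx; have [avv _] := vv'; have [aww _] := ww'.
have [<-|nx] := pselect (v' = x); first by exists v; apply: dualC.
have main u : dist v u = (dist x u).+1 -> dist v u = (dist v' u).+1 -> carrier H x.
  move=> h1 h2; have [t [sq _]] := quadrangle avv vx nx h2 h1.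
  by exists t; apply: (dual_square sq).
have := nearN x avv; case nvx: (near v v' x) => /= nvx'; last first.
  by exists v; apply/dualC/(dual_cross vv' vx); [exact: near_refl|rewrite nvx'].
have := nearN w avv; case nvw: (near v v' w) => /= nvw'; last first.
  apply: (main w) => //.
  by have := dist_adjP w avv; move: nvw'; rewrite /near; lia.
have e := dual_near vv' ww' nvw.
have := e w'; have := near_refl (adjC aww); rewrite (nearN _ aww) => /negbTE-> nvw2.
move: (e x) (e v); rewrite nvx (near_refl avv) /near => /esym exx /esym ev.
apply: (main w').
  have := dist_adjP x aww; have := dist_adjP v aww; move: exx ev.
  by rewrite (distC x w') (distC v w') (distC w x) (distC w v) in dx *; lia.
by have := dist_adjP w' avv; move: nvw2; rewrite /near; lia.
Qed.

Lemma carrier_convex H : convex (carrier H).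
Proof.
move=> v w x; move: {2}(dist v x) (erefl (dist v x)) => n.
elim: n v => [|n IH] v dn Hv Hw; first by rewrite -(dist_eq0 dn).
have [v1 [vv1 d1]] := dist_step dn => e.
have := dist_adjP w vv1; have := dist_tri x v1 w => h1 h2.
apply: (IH v1) => //; last by lia.
by apply: carrier_step Hv Hw vv1 _; lia.
Qed.

Lemma nearest A x v : A v -> exists g, A g /\ forall a, A a -> dist x g <= dist x a.
Proof.
move=> Av; have ex : exists n, `[< exists g, A g /\ dist x g = n >].
  by exists (dist x v); apply/asboolP; exists v.
case: (ex_minnP ex) => n /asboolP[g [Ag <-]] h; exists g; split=> // a Aa.
by apply: h; apply/asboolP; exists a.
Qed.

Lemma gate A x g : convex A -> A g -> (forall a, A a -> dist x g <= dist x a) ->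
  forall a, A a -> dist x a = dist x g + dist g a.
Proof.
move=> cA Ag mg a; move: {2}(dist a g) (erefl (dist a g)) => m.
elim/ltn_ind: m a => -[|m] IH a dm Aa; first by rewrite (dist_eq0 dm) distxx addn0.
have [a' [aa' d']] := dist_step dm.
have Aa' : A a' by apply: cA Aa Ag _; rewrite dist_adj // d' dm.
have := IH m (ltnSn m) a' d' Aa'; rewrite (distC g) (distC g) dm d'.
have := dist_adjP x aa'; rewrite !(distC _ x) => h1 h2.
have [//|h3] : dist x a = dist x g + m.+1 \/ dist x a' = (dist x a).+1 by lia.
exfalso; case: m dm IH d' h2 => [|m] dm IH d' h2; first by have := mg a Aa; lia.
have [a2 [a'a2 d2]] := dist_step d'.
have Aa2 : A a2 by apply: cA Aa' Ag _; rewrite dist_adj // d' d2.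
have := IH m (ltnW (ltnSn _)) a2 d2 Aa2; rewrite (distC g) d2 => h4.
have aa2 : a <> a2 by move=> e; move: dm; rewrite e d2; lia.
have [] : exists t, square a' a t a2 /\ dist a x = (dist t x).+1.
  apply: quadrangle => //; try exact: adjC; rewrite !(distC _ x); lia.
move=> t [sq]; rewrite !(distC _ x) => h5.
have [_ at_ ta2 _] := square_adj sq.
have daa2 : dist a a2 = 2.
  have := dist_tri a2 a g; have := dist_tri t a a2.
  by rewrite (dist_adj at_) (dist_adj ta2); lia.
have At : A t by apply: cA Aa Aa2 _; rewrite (dist_adj at_) (dist_adj ta2) daa2.
have dt : dist t g = m.+1.
  have := dist_tri t a g; have := dist_tri a2 t g.
  by rewrite (dist_adj at_) (dist_adj ta2); lia.
by have := IH m.+1 (ltnSn _) t dt At; rewrite (distC g); lia.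
Qed.

Lemma helly3 A B C : convex A -> convex B -> convex C ->
  A `&` B !=set0 -> A `&` C !=set0 -> B `&` C !=set0 -> A `&` B `&` C !=set0.
Proof.
move=> cA cB cC [x [Ax Bx]] [y [Ay Cy]] [z [Bz Cz]].
have [g [Cg mg]] := nearest x Cy; exists g.
by split=> //; split; [apply: cA Ax Ay _|apply: cB Bx Bz _]; rewrite -(gate cC Cg mg).
Qed.

Lemma convexI A B : convex A -> convex B -> convex (A `&` B).
Proof.
move=> cA cB v w x [Av Bv] [Aw Bw] e.
by split; [apply: cA e|apply: cB e].
Qed.

Lemma helly (I : eqType) (F : I -> set X) (s : seq I) A : convex A -> A !=set0 ->
  (forall i, i \in s -> convex (F i)) -> (forall i, i \in s -> A `&` F i !=set0) ->
  (forall i j, i \in s -> j \in s -> F i `&` F j !=set0) ->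
  exists x, A x /\ forall i, i \in s -> F i x.
Proof.
elim: s A => [|i s IH] A cA [x Ax] cF AF FF; first by exists x.
have si j : j \in s -> j \in i :: s by rewrite inE orbC => ->.
have ii : i \in i :: s by rewrite inE eqxx.
have [|||||y [[Ay Fy] h]] := IH (A `&` F i).
- by apply: convexI => //; apply: cF.
- exact: AF.
- by move=> j /si; apply: cF.
- by move=> j /si js; apply: helly3; auto.
- by move=> j k /si js /si ks; apply: FF.
by exists y; split=> // j; rewrite inE => /orP[/eqP->|/h].
Qed.

Lemma same_side_near H a b u v : dual H a b -> same_side (val H) u v ->
  near a b u = near a b v.
Proof.
move=> Hab; have [ab _] := Hab; elim=> {u v} [u v [uv nH]|//|u v _ ->//|u v w _ -> _ ->//].
have := nearN u ab; have := nearN v ab.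
case nu: (near a b u); case nv: (near a b v) => //= nv' nu'; case: nH.
  by have [] := dual_cross Hab uv nu nv'.
by have [] := dual_cross (dualC Hab) uv nu' nv.
Qed.

Lemma contact_carrier H K :
  contact H K <-> H <> K /\ exists v, carrier H v /\ carrier K v.
Proof.
split; move=> [nHK]; last first.
  move=> [v [[x [_ Hx]] [y [_ Ky]]]]; split=> // -[W [_ _ sepW]].
  by apply: (sepW _ _ v v Hx _ Ky _ (rst_refl _ _ _)); left.
move=> nsep; split=> //; apply: contrapT => nv; apply: nsep.
have [v0 [v0' Hv0]] := hyp_dual H; have [w0 [w0' Kw0]] := hyp_dual K.
have Hv0c : carrier H v0 by exists v0'.
have Kw0c : carrier K w0 by exists w0'.
have : exists n, `[< exists v w, [/\ carrier H v, carrier K w & dist v w = n] >].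
  by exists (dist v0 w0); apply/asboolP; exists v0, w0.
move=> ex; case: (ex_minnP ex) => n /asboolP[v [w [Hv Kw vw]]] mn.
have {ex}mn x y : carrier H x -> carrier K y -> dist v w <= dist x y.
  by move=> Hx Ky; rewrite vw; apply: mn; apply/asboolP; exists x, y.
have gv : forall a, carrier H a -> dist w a = dist w v + dist v a.
  by apply: gate (@carrier_convex H) Hv _ => a Ha; rewrite !(distC w); apply: mn.
have gw : forall a, carrier K a -> dist v a = dist v w + dist w a.
  by apply: gate (@carrier_convex K) Kw _ => a Ka; apply: mn.
case: n vw mn => [/dist_eq0 e|n vw mn]; first by case: nv; exists v; rewrite {2}e.
have [v' [vv' v'w]] := dist_step vw.
have [W Wv] := dual_ex vv'.
have nH a : carrier H a -> near v v' a.
  move=> /gv; have := dist_tri v' w a.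
  by rewrite /near (distC w v') (distC w v); lia.
have nK a : carrier K a -> near v' v a.
  by move=> /gw; have := dist_tri w v' a; rewrite /near; lia.
exists W; split.
- move=> e; subst W; have /nH : carrier H v' by exists v; apply: dualC.
  by rewrite /near distxx.
- by move=> e; subst W; case: nv; exists v; split=> //; exists v'.
- move=> E F x y /hyp_edge[a [b [-> Hab]]] xab /hyp_edge[c [d [-> Kcd]]] ycd.
  have Hx : carrier H x by case: xab => ->; [exists b|exists a; apply: dualC].
  have Ky : carrier K y by case: ycd => ->; [exists d|exists c; apply: dualC].
  move/(same_side_near Wv); rewrite (nH _ Hx) => /esym h.
  by move: (nK _ Ky); rewrite (nearN _ vv') h.
Qed.

End Walls.

(** * Free faces *)

Lemma exists_longest (T : Type) (P : seq T -> Prop) N s0 : P s0 ->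
  (forall s, P s -> size s <= N) ->
  exists s, P s /\ forall s', P s' -> size s' <= size s.
Proof.
move=> P0 PN; have ex : exists n, `[< exists s, P s /\ size s = n >].
  by exists (size s0); apply/asboolP; exists s0.
have bd n : `[< exists s, P s /\ size s = n >] -> n <= N.
  by move=> /asboolP[s [/PN ? <-]].
case: (ex_maxnP ex bd) => n /asboolP[s [Ps <-]] h; exists s; split=> // s' Ps'.
by apply: h; apply/asboolP; exists s'.
Qed.

Section NoFreeFaces.
Variable X : cubeComplex.
Hypothesis X_CAT0 : CAT0 X.
Hypothesis X_ulf : uniformly_locally_finite X.
Implicit Types (a b c d t u v w x y z : X) (C D M : set X) (s : seq X).
Implicit Types H K W : hyperplane X.

Let X_flag : forall v, flag_link v := X_CAT0.2.

Lemma nbrs_bound : exists N, forall v s,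
  uniq s -> (forall u, u \in s -> adjacent v u) -> size s <= N.
Proof.
have [N hN] := X_ulf; exists N => v s us vs.
pose A := [set E : set X | edge E /\ E v].
have fA : finite_set A by apply: card_le_finite (hN v) _; apply: finite_II.
apply: leq_trans (geq_card_fset_set (hN v)); rewrite -/A.
rewrite -(size_map (fun u => [set v; u])); apply: uniq_leq_size.
  rewrite map_inj_in_uniq // => x y xs ys /set2_eq[[]//|[e1 e2]].
  by case: (adj_neq (vs y ys)).
move=> _ /mapP[u us' ->]; rewrite in_fset_set //; apply/mem_set.
by split; [exists v, u; split=> //; apply: vs|left].
Qed.

Lemma nbrs_finite v : exists s, uniq s /\ forall u, u \in s <-> adjacent v u.
Proof.
have [N hN] := nbrs_bound.
pose P s := uniq s /\ forall u, u \in s -> adjacent v u.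
have [||s [[us vs] sm]] := @exists_longest _ P N [::]; first by [].
  by move=> s [us vs]; apply: hN vs.
exists s; split=> // u; split=> [|vu]; first exact: vs.
case: (boolP (u \in s)) => // us'; have /sm : P (u :: s).
  by split=> [|x]; rewrite /= ?us' // inE => /orP[/eqP->//|/vs].
by rewrite /= ltnn.
Qed.

Lemma maximal_cube_above C v : cube C -> C v ->
  exists M, maximal_cube M /\ C `<=` M.
Proof.
move=> cC Cv; have [N hN] := nbrs_bound.
have pair D s : cube D -> D v -> (forall u, u \in s <-> D u /\ adjacent v u) ->
    forall u w, u \in s -> w \in s -> u <> w -> lk v u w.
  move=> cD Dv Ds u w /Ds[Du vu] /Ds[Dw vw] uw.
  by have [c [_ sq]] := cube_lk cD Dv Du Dw vu vw uw; exists c.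
pose P s := [/\ uniq s, forall u, u \in s -> adjacent v u,
  forall u w, u \in s -> w \in s -> u <> w -> lk v u w &
  forall u, C u -> adjacent v u -> u \in s].
have [s0 [us0 Cs0]] := cube_nbrs cC Cv.
have P0 : P s0.
  split=> //; [by move=> u /Cs0[]|exact: pair Cs0|by move=> u ? ?; apply/Cs0].
have [|s [[us vs ls Cs] sm]] := exists_longest P0 (N := N).
  by move=> s [us vs _ _]; apply: hN vs.
have [M [cM Mv Ms]] := flag_cube X_flag vs ls; exists M; split; last first.
  by apply: cube_sub cC cM Cv Mv _ => u Cu /(Cs _ Cu)/Ms[].
split=> // D cD MD; apply/seteqP; split=> //.
have Dv := MD v Mv; have [s' [us' Ds']] := cube_nbrs cD Dv.
have ss' : {subset s <= s'} by move=> u /Ms[Mu vu]; apply/Ds'; split=> //; apply: MD.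
have le : size s' <= size s.
  apply: sm; split=> //; first by move=> u /Ds'[].
    exact: pair Ds'.
  by move=> u Cu vu; apply/ss'/Cs.
have [_ e] := uniq_min_size us ss' le.
apply: cube_sub cD cM Dv Mv _ => u Du vu.
by have [/(_ _)[]] := Ms u; rewrite ?e //; apply/Ds'.
Qed.

Hypothesis X_nff : no_free_faces X.

(* Every maximal cube containing [C] contains [y], so its face at [v] spanned
   by the neighbours other than [y] is free. *)
Lemma no_link_cone C v y : cube C -> C v -> adjacent v y -> ~ C y ->
  ~ (forall u, adjacent v u -> u <> y ->
       (forall c, C c -> adjacent v c -> c <> u -> lk v c u) -> lk v u y).
Proof.
move=> cC Cv vy nCy star.
have star_in M u : cube M -> C `<=` M -> M u -> adjacent v u -> u <> y -> lk v u y.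
  move=> cM CM Mu vu uy; apply: star => // c Cc vc cu.
  by have [x [_ sq]] := cube_lk cM (CM _ Cv) (CM _ Cc) Mu vc vu cu; exists x.
have maxy M : maximal_cube M -> C `<=` M -> M y.
  move=> [cM maxM] CM; have Mv := CM _ Cv.
  have [s [us Ms]] := cube_nbrs cM Mv.
  have [||D [cD Dv Ds]] := flag_cube X_flag (v := v) (s := y :: s).
  - by move=> u; rewrite inE => /orP[/eqP->//|/Ms[]].
  - move=> u w; rewrite !inE => /orP[/eqP->|/Ms[Mu vu]] /orP[/eqP->|/Ms[Mw vw]] // uw.
    + by apply/lkC/(star_in M) => // /esym.
    + exact: (star_in M).
    + by have [x [_ sq]] := cube_lk cM Mv Mu Mw vu vw uw; exists x.
  rewrite -(maxM D) //; first by have [] := (Ds y).1 (mem_head _ _).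
  apply: cube_sub cM cD Mv Dv _ => u Mu vu.
  by have [] : D u /\ adjacent v u by apply/Ds; rewrite inE orbC (_ : u \in s) //; apply/Ms.
have [M [maxM CM]] := maximal_cube_above cC Cv; have [cM hM] := maxM.
have Mv := CM _ Cv; have My := maxy M maxM CM.
have [s [us Ms]] := cube_nbrs cM Mv.
have [||F [cF Fv Fs]] := flag_cube X_flag (v := v) (s := rem y s).
- by move=> u; rewrite mem_rem_uniq // inE => /andP[_ /Ms[]].
- move=> u w; rewrite !mem_rem_uniq // !inE => /andP[_ /Ms[Mu vu]] /andP[_ /Ms[Mw vw]] uw.
  by have [x [_ sq]] := cube_lk cM Mv Mu Mw vu vw uw; exists x.
have nFy : ~ F y.
  by move=> Fy; have := (Fs y).2 (conj Fy vy); rewrite mem_rem_uniq // inE eqxx.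
have FM : F `<=` M.
  apply: cube_sub cF cM Fv Mv _ => u Fu vu; have := (Fs u).2 (conj Fu vu).
  by rewrite mem_rem_uniq // inE => /andP[_ /Ms[]].
have CF : C `<=` F.
  apply: cube_sub cC cF Cv Fv _ => u Cu vu.
  have [] // : F u /\ adjacent v u; apply/Fs; rewrite mem_rem_uniq // inE.
  apply/andP; split; first by apply/eqP => e; subst u.
  by apply/Ms; split=> //; apply: CM.
apply: (X_nff (F := F)); split=> //.
  by move=> [_ /(_ M cM FM) e]; apply: nFy; rewrite -e.
exists M; split=> // M' [[cM' maxM'] FM'].
apply/esym/hM => //; have CM' := subset_trans CF FM'.
have M'y := maxy M' (conj cM' maxM') CM'.
apply: cube_sub cM cM' Mv (CM' _ Cv) _ => u Mu vu.
have [->//|/eqP uy] := eqVneq u y; apply: FM'.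
have [] // : F u /\ adjacent v u; apply/Fs; rewrite mem_rem_uniq // inE.
by apply/andP; split; [apply/eqP|apply/Ms].
Qed.

Lemma four_cycle a b c d : adjacent a b -> adjacent b c -> adjacent c d ->
  adjacent d a -> a <> c -> b <> d -> square a b c d.
Proof.
move=> ab bc cd da ac bd.
have := dist_adjP X_CAT0 c ab; rewrite (dist_adj X_CAT0 bc) => h.
have {}h : dist a c = 2 by case: h => // -[/esym/(dist_eq0 X_CAT0)].
have [] := quadrangle X_CAT0 ab (adjC da) bd (u := c).
- by rewrite h (dist_adj X_CAT0 bc).
- by rewrite h (dist_adj X_CAT0 (adjC cd)).
move=> t [sq]; rewrite (dist_adj X_CAT0 bc) => -[/esym/(dist_eq0 X_CAT0) e].
by subst t.
Qed.

Lemma dist1_adj a b : dist a b = 1 -> adjacent a b.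
Proof.
by move=> /(dist_step X_CAT0)[c [ac /(dist_eq0 X_CAT0) e]]; subst c.
Qed.

Lemma lk_carrier H v u y : lk v u y -> dual H v u -> carrier H y.
Proof. by move=> [c sq] /(dual_square sq); exists c. Qed.

Lemma carrier_lk H v u y : adjacent v y -> u <> y -> dual H v u -> carrier H y ->
  lk v u y.
Proof.
move=> vy uy vu [y' yy']; have [avu _] := vu; have [ayy _] := yy'.
have nvy : near v u y.
  apply: contrapT => /negP; rewrite -(nearN X_CAT0 _ avu) => h.
  apply: uy; apply: (dual_inj X_CAT0 vu).
  exact: (dual_cross X_CAT0 vu vy (near_refl X_CAT0 avu)).
have e := dual_near X_CAT0 vu yy' nvy.
have y'v : v <> y'.
  by move=> e'; subst y'; apply: uy; apply: (dual_inj X_CAT0 vu); apply: dualC.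
have duy : dist u y = 2.
  have := dist_adjP X_CAT0 y avu; move: nvy.
  by rewrite /near (dist_adj X_CAT0 vy); lia.
exists y'; apply: four_cycle => //; try exact: adjC.
apply: dist1_adj; have := e u; have := near_refl X_CAT0 (adjC avu).
rewrite (nearN X_CAT0 _ avu) => /negbTE-> /esym; rewrite /near.
have := dist_adjP X_CAT0 u ayy; rewrite !(distC X_CAT0 _ u) duy; lia.
Qed.

Lemma carriers_determine C v x : cube C -> C v ->
  (forall c, C c -> c <> v -> adjacent v c /\ near v c x) ->
  (forall H, (forall c, C c -> carrier H c) -> carrier H x) -> x = v.
Proof.
move=> cC Cv Cc CH; apply: contrapT => xv.
case e : (dist v x) => [|n]; first by move/(dist_eq0 X_CAT0): e => /esym.
have [y [vy yx]] := dist_step X_CAT0 e.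
have nCy : ~ C y.
  move=> Cy; have [] := Cc y Cy; first by move/esym/(adj_neq vy).
  by move=> _; rewrite /near; lia.
apply: (no_link_cone cC Cv vy nCy) => u vu uy lkCu.
have [H Hu] := dual_ex vu.
have Hv : carrier H v by exists u.
apply: (@carrier_lk H) => //.
apply: (@carrier_convex _ X_CAT0 H v x) => //; last first.
  by rewrite (dist_adj X_CAT0 vy) e yx.
apply: CH => c Cc'; have [->//|/eqP cv] := eqVneq c v.
have [vc _] := Cc c Cc' cv.
have [->|/eqP cu] := eqVneq c u; first by exists v; apply: dualC.
by apply: lk_carrier (lkC (lkCu c Cc' vc cu)) Hu.
Qed.

Lemma carrier_sub_eq v x : (forall H, carrier H v -> carrier H x) -> x = v.
Proof.
move=> h; apply: (@carriers_determine [set v] v x) => //.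
- exact: cube_vertex.
- by move=> H Hv; apply/h/Hv.
Qed.

Lemma edge_carriers_sub v w x : adjacent v w ->
  (forall H, carrier H v -> carrier H w -> carrier H x) -> x = v \/ x = w.
Proof.
move=> vw h.
have main v' w' : adjacent v' w' -> near v' w' x ->
    (forall H, carrier H v' -> carrier H w' -> carrier H x) -> x = v'.
  move=> vw' n h'; apply: (@carriers_determine [set v'; w'] v' x).
  - by have [] := vw'.
  - by left.
  - by move=> c [->//|->].
  - by move=> H hc; apply: h'; apply: hc; [left|right].
case nv : (near v w x); [left; exact: main h|right].
apply: (main w v) => //; [exact: adjC|by rewrite (nearN X_CAT0 _ vw) nv|].
by move=> H ? ?; apply: h.
Qed.

Lemma adjacent_carriers v w : adjacent v w <-> v <> w /\
  forall x, (forall H, carrier H v -> carrier H w -> carrier H x) -> x = v \/ x = w.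
Proof.
split=> [vw|[vw h]].
  by split=> [|x]; [exact: adj_neq|exact: edge_carriers_sub].
case e : (dist v w) => [|n]; first by case: vw; apply: (dist_eq0 X_CAT0).
have [y [vy yw]] := dist_step X_CAT0 e.
have [|ey|<- //] := h y.
- move=> H Hv Hw; apply: carrier_convex Hv Hw _ => //.
  by rewrite (dist_adj X_CAT0 vy) yw e.
- by case: (adj_neq vy).
Qed.

End NoFreeFaces.

(** * Automorphisms of the contact graph *)

Definition cube_map (X : cubeComplex) n (q : {ffun 'I_n -> bool} -> X) :=
  forall a i j, i <> j ->
    square (q a) (q (flipc a i)) (q (flipc (flipc a i) j)) (q (flipc a j)).

Lemma cube_map_sub (X : cubeComplex) n m (q : {ffun 'I_n -> bool} -> X)
    (r : {ffun 'I_m -> bool} -> X) a0 b0 :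
  cube_map q -> cube_map r -> q a0 = r b0 ->
  (forall i, exists k, q (flipc a0 i) = r (flipc b0 k)) -> range q `<=` range r.
Proof.
move=> cq cr e0 e1.
pose P a := exists b, q a = r b /\ forall i, exists k, q (flipc a i) = r (flipc b k).
suff PA a : P a by move=> _ [a _ <-]; have [b [-> _]] := PA a; exists b.
move: a; apply: (@hypercube_ind n P a0); first by exists b0.
move=> a i [b [e h]]; have [k ek] := h i; exists (flipc b k); split=> // j.
have [<-|/eqP ij] := eqVneq i j; first by exists k; rewrite !flipcK.
have [k' ek'] := h j; exists k'.
have sq := cq a i j ij; have kk' : k <> k'.
  by move=> kk'; have [_] := square_neq sq; rewrite ek ek' kk'.
by apply: square_uniq sq _; rewrite e ek ek'; apply: cr.
Qed.

Lemma hypercube_cube (X : cubeComplex) n (q : {ffun 'I_n -> bool} -> X) :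
  (forall v : X, flag_link v) -> (forall a i, adjacent (q a) (q (flipc a i))) ->
  cube_map q -> cube (range q).
Proof.
move=> X_flag aq cq; pose a0 : {ffun 'I_n -> bool} := [ffun=> false].
have [||D [cD Da0 Ds]] := flag_cube X_flag (v := q a0) (s := [seq q (flipc a0 i) | i <- enum 'I_n]).
- by move=> _ /mapP[i _ ->]; apply: aq.
- move=> _ _ /mapP[i _ ->] /mapP[j _ ->] qij; exists (q (flipc (flipc a0 i) j)).
  by apply: cq => ij; apply: qij; rewrite ij.
have [m [r ch]] := chartP cD; have [b0 e0] := chart_onto ch Da0.
have cr : cube_map r by move=> b i j; apply: (chart_square ch).
have rD : range r = D by case: ch.
suff -> : range q = D by [].
rewrite -rD; apply/seteqP; split.
  apply: (cube_map_sub cq cr e0) => i.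
  have [Dq qq] : D (q (flipc a0 i)) /\ adjacent (q a0) (q (flipc a0 i)).
    by apply/Ds/mapP; exists i; rewrite ?mem_enum.
  by rewrite e0 in qq; apply: (chart_adjE ch).
apply: (cube_map_sub cr cq (esym e0)) => k.
have /mapP[i _ ->] : r (flipc b0 k) \in [seq q (flipc a0 i) | i <- enum 'I_n].
  by apply/Ds; rewrite e0; split; [exact: (chart_in ch)|exact: (chart_adj ch)].
by exists i.
Qed.

Section Rigidity.
Variable X : cubeComplex.
Hypothesis X_CAT0 : CAT0 X.
Hypothesis X_ulf : uniformly_locally_finite X.
Hypothesis X_nff : no_free_faces X.
Implicit Types (a b c d t u v w x y z : X).
Implicit Types H K W : hyperplane X.

Lemma carriers_finite v : exists s : seq (hyperplane X), forall H, carrier H v -> H \in s.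
Proof.
have [s [_ vs]] := nbrs_finite X_ulf v.
suff [S hS] : exists S : seq (hyperplane X), forall H u, u \in s -> dual H v u -> H \in S.
  by exists S => H [u Hu]; apply: (hS H u) => //; apply/vs; case: Hu.
elim: s {vs} => [|u s [S hS]]; first by exists [::].
have [[K Ku]|nK] := pselect (exists K, dual K v u).
  exists (K :: S) => H u'; rewrite !inE => /orP[/eqP->|us] Hu.
    by rewrite (dual_uniq Hu Ku) eqxx.
  by rewrite (hS H u') ?orbT.
exists S => H u'; rewrite inE => /orP[/eqP->|] Hu; last exact: hS Hu.
by case: nK; exists H.
Qed.

Lemma carrier_clique (g : graphAut (contact_graph X)) H K v :
  carrier H v -> carrier K v -> carrier (val g H) `&` carrier (val g K) !=set0.
Proof.
move=> Hv Kv; have [->|HK] := pselect (H = K).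
  by have [a [b h]] := hyp_dual (val g K); exists a; split; exists b.
have HK' : contact H K by apply/(contact_carrier X_CAT0); split=> //; exists v.
have /graph_preservingP/(_ H K)[_ /(_ HK')] := valP g.
by move=> /(contact_carrier X_CAT0)[_ [x [? ?]]]; exists x.
Qed.

Lemma clique_vertex (g : graphAut (contact_graph X)) v :
  exists x, forall H, carrier H v -> carrier (val g H) x.
Proof.
have [s hs] := carriers_finite v.
pose s' := [seq H <- s | `[< carrier H v >]].
have [|||||x [_ hx]] :=
    @helly X X_CAT0 _ (fun H : hyperplane X => carrier (val g H)) s' setT.
- by [].
- by exists v.
- by move=> H _; apply: carrier_convex.
- move=> H _; have [a [b h]] := hyp_dual (val g H).
  by exists a; split=> //; exists b.
- move=> H K; rewrite !mem_filter => /andP[/asboolP Hv _] /andP[/asboolP Kv _].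
  exact: carrier_clique Hv Kv.
exists x => H Hv; apply: hx; rewrite mem_filter hs // andbT.
exact/asboolP.
Qed.

Lemma graph_autVK (g : graphAut (contact_graph X)) : cancel (val g) (val (g^-1)%g).
Proof. exact: sb_funK. Qed.

Lemma vertex_map (g : graphAut (contact_graph X)) v :
  exists x, forall H, carrier H v <-> carrier (val g H) x.
Proof.
have [x hx] := clique_vertex g v; have [y hy] := clique_vertex (g^-1)%g x.
have e : y = v.
  apply: (carrier_sub_eq X_CAT0 X_ulf X_nff) => H /hx/hy.
  by rewrite graph_autVK.
by exists x => H; split=> [/hx//|/hy]; rewrite graph_autVK e.
Qed.

Section VertexMap.
Variables (phi : graphAut (contact_graph X) -> X -> X).
Hypothesis phiP : forall (g : graphAut (contact_graph X)) v H,
  carrier H v <-> carrier (val g H) (phi g v).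
Implicit Types g : graphAut (contact_graph X).

Lemma phiK g : cancel (phi g) (phi (g^-1)%g).
Proof.
move=> v; apply: (carrier_sub_eq X_CAT0 X_ulf X_nff) => H /(phiP g)/(phiP (g^-1)%g).
by rewrite graph_autVK.
Qed.

Lemma phiVK g : cancel (phi (g^-1)%g) (phi g).
Proof. by have := phiK (g^-1)%g; rewrite invgK. Qed.

Lemma phi_adj g v w : adjacent v w -> adjacent (phi g v) (phi g w).
Proof.
move=> /(adjacent_carriers X_CAT0 X_ulf X_nff)[vw h].
apply/(adjacent_carriers X_CAT0 X_ulf X_nff).
split=> [/(can_inj (phiK g))//|x hx].
have [|<-|<-] := h (phi (g^-1)%g x); [|by left; rewrite phiVK|by right; rewrite phiVK].
move=> H /(phiP g) Hv /(phiP g) Hw.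
by have /(phiP (g^-1)%g) := hx _ Hv Hw; rewrite graph_autVK.
Qed.

Lemma phi_square g a b c d : square a b c d ->
  square (phi g a) (phi g b) (phi g c) (phi g d).
Proof.
move=> sq; have [ab bc cd da] := square_adj sq; have [ac bd] := square_neq sq.
by apply: (four_cycle X_CAT0); try exact: phi_adj; move/(can_inj (phiK g)).
Qed.

Lemma phi_lk g v u w : lk v u w -> lk (phi g v) (phi g u) (phi g w).
Proof. by move=> [c sq]; exists (phi g c); apply: phi_square. Qed.

Lemma phi_cube g (C : set X) : cube C -> cube (phi g @` C).
Proof.
move=> /chartP[n [p ch]]; have rp : range p = C by case: ch.
rewrite -rp image_comp; apply: hypercube_cube X_CAT0.2 _ _.
- by move=> a i; apply/phi_adj/(chart_adj ch).
- by move=> a i j ij; apply/phi_square/(chart_square ch).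
Qed.

Definition phi_bij g : selfbij X := SelfBij (phiK g) (phiVK g).

Lemma phi_cubical g : phi_bij g \in @cubical X.
Proof.
apply/cubicalP => C; split; last exact: phi_cube.
move/(phi_cube (g^-1)%g); rewrite image_comp (_ : _ \o _ = id) ?image_id //.
by apply/funext/phiK.
Qed.

Definition phi_aut g : cubeAut X := exist _ (phi_bij g) (phi_cubical g).

Lemma dual_aut (f : cubeAut X) H v w :
  dual H v w -> dual (hyp_image f H) (val f v) (val f w).
Proof.
move=> [vw Hvw]; split; first exact: adjacent_aut.
by exists [set v; w] => //; rewrite image_setU !image_set1.
Qed.

(* The edge at [phi g v] dual to [val g H] is [phi g] of an edge [vx], and [w]
   and [x] have the same star in the link of [v]; by [edge_carriers_sub] they
   coincide. *)
Lemma phi_dual g H v w : dual H v w -> dual (val g H) (phi g v) (phi g w).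
Proof.
move=> Hvw; have [vw _] := Hvw.
have /(phiP g)[u gu] : carrier H v by exists w.
have [vu _] := gu; pose x := phi (g^-1)%g u.
have ux : u = phi g x by rewrite /x phiVK.
have vx : adjacent v x by have := phi_adj (g^-1)%g vu; rewrite phiK.
suff [e|<-] : x = v \/ x = w by [case: (adj_neq vx)|rewrite -ux].
apply: (edge_carriers_sub X_CAT0 X_ulf X_nff vw) => K [y Kvy] Kw.
have [vy _] := Kvy.
have Hy : carrier H y.
  have [->|/eqP yw] := eqVneq y w; first by exists v; apply: dualC.
  exact: lk_carrier (lkC (carrier_lk X_CAT0 vw yw Kvy Kw)) Hvw.
have [->|/eqP xy] := eqVneq x y; first by exists v; apply: dualC.
have uy : u <> phi g y by rewrite ux => /(can_inj (phiK g)).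
have := carrier_lk X_CAT0 (phi_adj g vy) uy gu ((phiP g _ _).1 Hy).
move/(phi_lk (g^-1)%g); rewrite !phiK -/x => /lkC l.
exact: lk_carrier l Kvy.
Qed.

Lemma iota_phi g : iota_aut (phi_aut g) = g.
Proof.
apply: val_inj; apply: selfbijP => H.
have [v [w Hvw]] := hyp_dual H.
exact: dual_uniq (dual_aut (phi_aut g) Hvw) (phi_dual g Hvw).
Qed.

End VertexMap.

Lemma iota_surjective (g : graphAut (contact_graph X)) : exists f, iota_aut f = g.
Proof.
pose phi g := projT1 (choice (vertex_map g)).
have h g' := projT2 (choice (vertex_map g')).
by exists (phi_aut (phi := phi) h g); apply: iota_phi.
Qed.

Lemma carrier_aut (f : cubeAut X) H v :
  carrier H v -> carrier (hyp_image f H) (val f v).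
Proof. by move=> [w Hvw]; exists (val f w); apply: dual_aut. Qed.

Lemma iota_injective : injective (@iota_aut X).
Proof.
move=> f f' e; apply: val_inj; apply: selfbijP => v.
apply: (carrier_sub_eq X_CAT0 X_ulf X_nff) => H Hv.
have fK : val (f'^-1)%g (val f' v) = v by apply: sb_funK.
have e' K : hyp_image f K = hyp_image f' K.
  by have /(congr1 (fun k : graphAut (contact_graph X) => val k K)) := e.
have := carrier_aut f (carrier_aut (f'^-1)%g Hv).
by rewrite fK e' hyp_imageVK.
Qed.

End Rigidity.

Theorem mainTheorem2 (X : cubeComplex)
    (X_CAT0 : CAT0 X)
    (X_ulf : uniformly_locally_finite X)
    (X_nff : no_free_faces X) :
  {morph @iota_aut X : f g / (f * g)%g >-> (f * g)%g} /\
  bijective (@iota_aut X).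
Proof.
split=> [f g|].
  by apply: val_inj; apply: selfbijP => H; apply: hyp_imageM.
have [h hK] := choice (iota_surjective X_CAT0 X_ulf X_nff).
exists h => // f; apply: (iota_injective X_CAT0 X_ulf X_nff).
exact: hK.
Qed.
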